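(* For any frequency $\lambda$ we have $$\frac{L(\lambda)}2\le S_p(\lambda)\le\frac{L(\lambda)}p\quad\text{for }1\le p\le2,$$ $$S_p(\lambda)=\frac{L(\lambda)}2\quad\text{for }2\le p<\infty.$$ Moreover, for $1\le p\le2$, we have that $pS_p(\lambda)$ is increasing in $p$, $S_p(\lambda)$ is a Lipschitz function of $p$, and for almost every $p$ $$-\frac{S_p(\lambda)}p\le\frac{dS_p(\lambda)}{dp}\le0.$$
   Context: A frequency is a strictly increasing sequence $\lambda=(\lambda_n)_{n\ge1}$ of non-negative real numbers tending to $\infty$. A $\lambda$-Dirichlet series is a formal series $D=\sum a_ne^{-\lambda_ns}$ with complex coefficients $(a_n)$; it is a $\lambda$-Dirichlet polynomial if only finitely many $a_n$ are non-zero. For $1\le p<\infty$ and a $\lambda$-Dirichlet polynomial $D$, $$\|D\|_p=\lim_{T\to\infty}\Big(\frac1{2T}\int_{-T}^T\Big|\sum_n a_ne^{-\lambda_nit}\Big|^pdt\Big)^{1/p}.$$ The Hardy space $\mathcal{H}_p(\lambda)$ is the completion of the space of $\lambda$-Dirichlet polynomials under $\|\cdot\|_p$; the coefficient functionals $D\mapsto a_n$ extend continuously ($|a_n|\le\|D\|_p$) and elements of $\mathcal{H}_p(\lambda)$ are identified with the formal $\lambda$-Dirichlet series given by their coefficients. $L(\lambda)=\limsup_{n\to\infty}\frac{\log n}{\lambda_n}\in[0,\infty]$. For a $\lambda$-Dirichlet series $D=\sum a_ne^{-\lambda_ns}$ let $D_\sigma=\sum a_ne^{-\lambda_n\sigma}e^{-\lambda_ns}$,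 $\sigma_a(D)=\inf\{\sigma\in\mathbb{R}: D\text{ converges absolutely on }[\operatorname{Re}s>\sigma]\}$ and $\sigma_p(D)=\inf\{\sigma\in\mathbb{R}: D_\sigma\in\mathcal{H}_p(\lambda)\}$. Then $$S_p(\lambda)=\sup_D\big(\sigma_a(D)-\sigma_p(D)\big)=\sup_{D\in\mathcal{H}_p(\lambda)}\sigma_a(D),$$ where the first supremum is over all $\lambda$-Dirichlet series $D$ and $\infty-\infty$ is understood to be $0$. *)

(* Defs.v *)
From HB Require Import structures.
From mathcomp Require Import all_boot all_order all_algebra.
From mathcomp Require Import complex.
From mathcomp Require Import all_classical all_reals all_analysis.
Set Implicit Arguments.
Unset Strict Implicit.
Unset Printing Implicit Defensive.
Import Order.TTheory GRing.Theory Num.Theory.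
Import numFieldNormedType.Exports.
Local Open Scope classical_set_scope.
Local Open Scope complex_scope.
Local Open Scope ring_scope.

(* Sequences are indexed from 0: [lam n] is the (n+1)-st frequency, and [a n]
   is its coefficient. *)

Definition frequency {R : realType} (lam : nat -> R) : Prop :=
  [/\ increasing_seq lam, forall n, 0 <= lam n & lam n @[n --> \oo] --> +oo].

(* The shift n.+1 comes from indexing from 0. The first term may divide by
   lam 0 = 0, which does not affect the limsup. *)
Definition freqL {R : realType} (lam : nat -> R) : \bar R :=
  limn_esup (fun n => (ln n.+1%:R / lam n)%:E).

Definition cexp {R : realType} (z : R[i]) : R[i] :=
  (expR (complex.Re z))%:C * (cos (complex.Im z) +i* sin (complex.Im z)).

(* A formal lam-Dirichlet series is identified with its coefficient sequence;
   this is its general term at the point s. *)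
Definition dterm {R : realType} (lam : nat -> R) (a : nat -> R[i])
    (s : R[i]) (n : nat) : R[i] :=
  a n * cexp (- (lam n)%:C * s).

Definition dpoly {R : realType} (a : nat -> R[i]) : Prop :=
  finite_set [set n | a n != 0].

(* Meaningful when [a] is a Dirichlet polynomial: the sum over nat is then
   finitely supported. *)
Definition deval {R : realType} (lam : nat -> R) (a : nat -> R[i])
    (s : R[i]) : R[i] :=
  \sum_(n \in [set: nat]) dterm lam a s n.

Definition dnorm {R : realType} (lam : nat -> R) (p : R)
    (a : nat -> R[i]) : R :=
  lim (((2 * T)^-1 *
    \int[lebesgue_measure]_(t in `[- T, T])
       (ComplexField.Normc.normc (deval lam a (0 +i* t)) `^ p)) `^ p^-1
    @[T --> +oo]).

(* The set of formal series representing the elements of the completion of the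
   Dirichlet polynomials under [dnorm lam p]: an element of the completion is
   given by a Cauchy sequence [P] of Dirichlet polynomials, and its n-th
   coefficient, by continuous extension of the coefficient functional, is the
   limit of the n-th coefficients of the [P k]. *)
Definition hardy {R : realType} (lam : nat -> R) (p : R)
    (a : nat -> R[i]) : Prop :=
  exists P : nat -> nat -> R[i],
    [/\ forall k, dpoly (P k),
        forall e : R, 0 < e -> exists N : nat, forall j k : nat,
          (N <= j)%N -> (N <= k)%N ->
          dnorm lam p (fun n => P j n - P k n) < e &
        forall n, ComplexField.Normc.normc (P k n - a n) @[k --> \oo] --> 0].

Definition dtranslate {R : realType} (lam : nat -> R) (a : nat -> R[i])
    (sigma : R) : nat -> R[i] :=
  fun n => a n * cexp (- (lam n * sigma)%:C).

Definition abs_cvg_at {R : realType} (lam : nat -> R) (a : nat -> R[i])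
    (s : R[i]) : Prop :=
  cvgn (series (fun n => ComplexField.Normc.normc (dterm lam a s n))).

Definition sigma_a {R : realType} (lam : nat -> R) (a : nat -> R[i])
    : \bar R :=
  ereal_inf [set sigma%:E | sigma in
    [set sigma : R | forall s : R[i], sigma < complex.Re s -> abs_cvg_at lam a s]].

Definition sigma_p {R : realType} (lam : nat -> R) (p : R) (a : nat -> R[i])
    : \bar R :=
  ereal_inf [set sigma%:E | sigma in
    [set sigma : R | hardy lam p (dtranslate lam a sigma)]].

(* Subtraction with the convention that the difference of two equal infinities
   is 0; the library's value for it is -oo. *)
Definition esub0 {R : realType} (x y : \bar R) : \bar R :=
  if x == y then 0%E else (x - y)%E.

Definition S_p {R : realType} (lam : nat -> R) (p : R) : \bar R :=
  ereal_sup [set esub0 (sigma_a lam a) (sigma_p lam p a)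
            | a in [set: nat -> R[i]]].

(* Real-valued version of [S_p]; the junk value 0 occurs only for infinite
   [S_p]. *)
Definition S_pR {R : realType} (lam : nat -> R) (p : R) : R :=
  fine (S_p lam p).

(* Main.v *)
(* Write [e(p)] for [S_p]. Everything reduces to three facts: [e] is decreasing,
   [p * e(p)] is increasing, and [e(2) <= L / 2 <= e(p)] for all [p].

   The first is Jensen's inequality. The upper bound at [p = 2] is Parseval plus
   Cauchy-Schwarz. The lower bound takes a series whose signs on each dyadic
   block are chosen so that the L^p norm of the block is at most a constant times
   the square root of its length.

   For the second, let [D] lie in [H_p] and suppose that [sum |a_n| exp(- u lam_n)]
   converges. Multiplying [a_n] by [exp(- (lam_n - k)^2 / 2)] does not increase
   the [H_p] norm (a Gaussian is a limit of powers of cosines, and multiplying by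
   a cosine averages two translates) and gives a sup norm at most
   [C exp(u k)], hence an [H_q] norm at most [C exp((1 - p/q) u k)]. Summing these
   pieces against [exp(- w k)] with [w > (1 - p/q) u] yields an element of [H_q]
   whose coefficients are comparable to [a_n exp(- w lam_n)]. Hence
   [sigma_a D - (1 - p/q) sigma_a D <= e(q)], that is [e(p) <= (q/p) e(q)].

   Monotonicity of [e] and [p * e(p)] makes [e] Lipschitz on [1, 2] and bounds its
   derivative wherever it exists, which is almost everywhere by Radon-Nikodym and
   Lebesgue's differentiation theorem. *)

From HB Require Import structures.
Require Import Defs.
From mathcomp Require Import all_boot all_order all_algebra.
From mathcomp Require Import complex.
From mathcomp Require Import all_classical all_reals all_analysis.
From mathcomp Require Import ring lra.
Import Order.TTheory GRing.Theory Num.Theory.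
Import numFieldNormedType.Exports.
Local Open Scope classical_set_scope.
Local Open Scope ring_scope.

Set Implicit Arguments.
Unset Strict Implicit.
Unset Printing Implicit Defensive.

(** * Means of almost periodic functions *)

Section Mean.
Context {R : realType}.
Implicit Types (f g : R -> R).
Local Notation mu := (@lebesgue_measure R).

(** [dnorm] is a [lim], so it says nothing until the limit is known to exist. Each [|D(it)|^p] is
    therefore shown to be a uniform limit of trigonometric polynomials (a Bernstein polynomial
    evaluated at a rescaled [|D(it)|^2]), which makes its averages converge. Norm inequalities are
    then pointwise inequalities between linear combinations of such functions, averaged; this is why
    Jensen and Minkowski enter through tangent-line inequalities.

    The second obstacle: an element of the Hardy space is not a function, only a coefficientwise
    limit of polynomials with bounded norms. Its Gaussian pieces cannot be formed directly and are
    cut out of approximants, a different one for each piece. The weight is Gaussian because it must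
    be positive, a contractive multiplier for every [p >= 1], and smaller than any exponential, so
    that convergence at [u] becomes growth [exp(u k)] whatever [u] is.

    The factor [q/p] is a fixed point: one interpolation step sends an admissible abscissa [u] to
    [(1 - p/q) u + S_q], up to an arbitrarily small loss, and [(q/p) S_q] is where this map stops
    improving [u]. *)

Definition avg (f : R -> R) (T : R) : R :=
  (2 * T)^-1 * \int[mu]_(t in `[- T, T]) f t.

Definition has_mean (f : R -> R) (m : R) : Prop := avg f T @[T --> +oo] --> m.

Lemma continuous_integrable f (a b : R) : continuous f ->
  mu.-integrable `[a, b] (EFin \o f).
Proof.
move=> cf; apply: continuous_compact_integrable; first exact: segment_compact.
exact: continuous_subspaceT.
Qed.

Lemma avgD f g T : continuous f -> continuous g ->
  avg (fun t => f t + g t) T = avg f T + avg g T.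
Proof.
move=> cf cg; rewrite /avg -mulrDr; congr (_ * _).
apply: RintegralD; [exact: measurable_itv|exact: continuous_integrable..].
Qed.

Lemma avgZ c f T : continuous f -> avg (fun t => c * f t) T = c * avg f T.
Proof.
move=> cf; rewrite /avg mulrCA; congr (_ * _).
apply: RintegralZl; [exact: measurable_itv|exact: continuous_integrable].
Qed.

Lemma avg_cst c (T : R) : 0 < T -> avg (fun=> c) T = c.
Proof.
move=> T0; rewrite /avg Rintegral_cst; last exact: measurable_itv.
have -> : fine (mu `[- T, T]) = 2 * T.
  rewrite lebesgue_measure_itv/= lte_fin ifT; last lra.
  rewrite /= ; lra.
by field; rewrite gt_eqF.
Qed.

Lemma le_avg f g (T : R) : 0 < T -> continuous f -> continuous g ->
  (forall t, f t <= g t) -> avg f T <= avg g T.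
Proof.
move=> T0 cf cg fg; rewrite /avg ler_pM2l ?invr_gt0 ?mulr_gt0//.
apply: le_Rintegral;
  [exact: measurable_itv|exact: continuous_integrable|exact: continuous_integrable|by move=> t _].
Qed.

Lemma has_mean_unique f m m' : has_mean f m -> has_mean f m' -> m = m'.
Proof. by move=> h h'; apply: (cvg_unique _ h h'). Qed.

Lemma has_meanD f g m m' : continuous f -> continuous g ->
  has_mean f m -> has_mean g m' -> has_mean (fun t => f t + g t) (m + m').
Proof.
move=> cf cg hf hg; rewrite /has_mean.
under eq_fun do rewrite avgD//.
exact: cvgD.
Qed.

Lemma has_meanZ c f m : continuous f ->
  has_mean f m -> has_mean (fun t => c * f t) (c * m).
Proof.
move=> cf hf; rewrite /has_mean.
under eq_fun do rewrite avgZ//.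
exact: cvgMr.
Qed.

Lemma has_mean_cst c : has_mean (fun=> c) c.
Proof.
apply: cvg_near_cst; near=> T; rewrite avg_cst//.
Unshelve. all: by end_near. Qed.

Lemma le_has_mean f g m m' : continuous f -> continuous g ->
  (forall t, f t <= g t) -> has_mean f m -> has_mean g m' -> m <= m'.
Proof.
move=> cf cg fg hf hg; apply: (ler_cvg_to hf hg).
by near=> T; apply: le_avg.
Unshelve. all: by end_near. Qed.

Lemma has_mean_cos (al be : R) : al != 0 -> has_mean (fun t => cos (al * t + be)) 0.
Proof.
move=> al0.
have dF (t : R) : is_derive t 1 (fun t => al^-1 * sin (al * t + be)) (cos (al * t + be)).
  apply: is_derive_eq; rewrite ?mulr1 ?scaler1 /GRing.scale/=.
  by rewrite ?mulr0 ?mul0r ?addr0 ?add0r ?mulr1; field.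
have cc : continuous (fun t : R => cos (al * t + be)).
  move=> t; apply: (@continuous_comp _ _ _ (fun t => al * t + be)); last exact: continuous_cos.
  by apply: cvgD; [apply: cvgMr|exact: cvg_cst].
have cF : continuous (fun t : R => al^-1 * sin (al * t + be)).
  move=> t; apply: cvgMr; apply: (@continuous_comp _ _ _ (fun t => al * t + be));
    last exact: continuous_sin.
  by apply: cvgD; [apply: cvgMr|exact: cvg_cst].
have I (T : R) : 0 < T -> \int[mu]_(t in `[- T, T]) cos (al * t + be) =
   al^-1 * sin (al * T + be) - al^-1 * sin (al * (- T) + be).
  move=> T0; rewrite /Rintegral (continuous_FTC2 (F := fun t : R => al^-1 * sin (al * t + be)))//.
  - lra.
  - exact: continuous_subspaceT.
  - split.
    + by move=> x _; exact: ex_derive.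
    + by apply: cvg_at_right_filter; exact: cF.
    + by apply: cvg_at_left_filter; exact: cF.
  - by move=> x _; rewrite derive1E; exact: derive_val.
have B (T : R) : 0 < T -> `|avg (fun t => cos (al * t + be)) T| <= `|al|^-1 * T^-1.
  move=> T0; rewrite /avg I// normrM gtr0_norm ?invr_gt0 ?mulr_gt0//.
  rewrite -mulrBr normrM normfV.
  have -> : `|al|^-1 / T = (2 * T)^-1 * (`|al|^-1 * 2) by field; rewrite normr_eq0 al0 gt_eqF.
  apply: ler_wpM2l; first by rewrite invr_ge0 mulr_ge0// ltW.
  apply: ler_wpM2l; first by rewrite invr_ge0.
  apply: (le_trans (ler_normB _ _)).
  have := sin_max (al * T + be); have := sin_max (al * (- T) + be); lra.
apply/cvgr0Pnorm_le => e e0.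
near=> T.
have T0 : 0 < T by [].
apply: (le_trans (B T T0)).
rewrite -ler_pdivlMl ?invr_gt0 ?normr_gt0// invrK.
rewrite -[leRHS]invrK lef_pV2 ?posrE ?invr_gt0 ?mulr_gt0 ?normr_gt0//.
Unshelve. all: by end_near. Qed.

(** Averaging does not increase the uniform distance, so for large [T] the averages of [f] stay
    close to the mean of an approximant; that mean serves as the centre of a Cauchy ball. *)
Lemma cauchy_mean f : continuous f ->
  (forall e : R, 0 < e -> exists g m, [/\ continuous g, has_mean g m & forall t, `|f t - g t|
    <= e]) ->
  exists m, has_mean f m.
Proof.
move=> cf H; suff : cvg (avg f T @[T --> +oo]) by move=> ?; exists (lim (avg f T @[T --> +oo])).
apply/cauchy_cvgP/cauchy_exP => e e0.
have e4 : 0 < e / 4 by rewrite divr_gt0.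
have [g [m [cg hg fg]]] := H _ e4.
exists m => /=; rewrite /ball/=.
move/cvgrPdist_lt : hg => /(_ _ e4) hg.
near=> T.
have T0 : 0 < T by [].
have h1 : avg f T <= avg g T + e / 4.
  rewrite -[X in _ + X](avg_cst _ T0) -avgD//; last exact: cst_continuous.
  apply: le_avg => // [|t]; last by have := fg t; rewrite ler_norml; lra.
  by move=> t; apply: cvgD; [exact: cg|exact: cvg_cst].
have h2 : avg g T <= avg f T + e / 4.
  rewrite -[X in _ + X](avg_cst _ T0) -avgD//; last exact: cst_continuous.
  apply: le_avg => // [|t]; last by have := fg t; rewrite ler_norml; lra.
  by move=> t; apply: cvgD; [exact: cf|exact: cvg_cst].
have h3 : `|m - avg g T| < e / 4 by near: T.
move: h3; rewrite /ball_ /= !ltr_norml. move=> /andP[? ?]; apply/andP; split; lra.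
Unshelve. all: by end_near. Qed.

End Mean.

(** * Bernstein polynomials and uniform approximation on the unit interval *)

Section Bernstein.
Context {R : realType}.

(* [bern n f x] is the expectation of [f] under the binomial law with
   parameters [n] and [x]. *)
Fixpoint bern (n : nat) (f : nat -> R) (x : R) : R :=
  if n is n'.+1 then x * bern n' (fun k => f k.+1) x + (1 - x) * bern n' f x
  else f 0%N.

Lemma le_bern n (f g : nat -> R) x : 0 <= x <= 1 ->
  (forall k, (k <= n)%N -> f k <= g k) -> bern n f x <= bern n g x.
Proof.
move=> /andP[x0 x1]; elim: n f g => [|n IH] f g fg /=; first exact: fg.
apply: lerD; apply: ler_wpM2l; rewrite ?subr_ge0//; apply: IH => k kn; apply: fg => //.
exact: leq_trans kn _.
Qed.

Lemma bernD n (f g : nat -> R) x :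
  bern n (fun k => f k + g k) x = bern n f x + bern n g x.
Proof. by elim: n f g => [//|n IH] f g /=; rewrite !IH; ring. Qed.

Lemma bernZ n c (f : nat -> R) x : bern n (fun k => c * f k) x = c * bern n f x.
Proof. by elim: n f => [//|n IH] f /=; rewrite !IH; ring. Qed.

Lemma bern_cst n c x : bern n (fun=> c) x = c :> R.
Proof. by elim: n => [//|n IH] /=; rewrite !IH; ring. Qed.

Lemma bern_id n x : bern n (fun k => k%:R) x = n%:R * x :> R.
Proof.
elim: n => [|n IH] /=; first by rewrite mul0r.
under [X in bern n X]eq_fun do rewrite -natr1.
by rewrite bernD bern_cst IH -natr1; ring.
Qed.

Lemma bern_sqr n x :
  bern n (fun k => k%:R ^+ 2) x = n%:R * x * (1 - x) + (n%:R * x) ^+ 2 :> R.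
Proof.
elim: n => [|n IH] /=; first by rewrite !mul0r expr0n addr0.
have -> : (fun k : nat => k.+1%:R ^+ 2) = (fun k : nat => k%:R ^+ 2 + (2 * k%:R + 1) :> R).
  by apply/funext => k; rewrite -natr1; ring.
by rewrite !bernD bernZ bern_cst bern_id IH -natr1; ring.
Qed.

Lemma bern_variance n x :
  bern n (fun k => (k%:R - n%:R * x) ^+ 2) x = n%:R * x * (1 - x) :> R.
Proof.
have -> : (fun k : nat => (k%:R - n%:R * x) ^+ 2) =
    (fun k : nat => k%:R ^+ 2 + ((- (2 * (n%:R * x))) * k%:R + (n%:R * x) ^+ 2) :> R).
  by apply/funext => k; ring.
by rewrite !bernD bernZ bern_cst bern_id bern_sqr; ring.
Qed.

(** Uniform continuity with a quadratic error in place of a [delta]: beyond distance [d] the term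
    [C * (y - x)^2] already exceeds twice the bound of [phi]. In this form the expectation under the
    binomial law is just its variance. *)
Lemma uniform_modulus (phi : R -> R) : continuous phi -> forall e : R, 0 < e ->
  exists C : R, 0 <= C /\ forall x y : R, 0 <= x <= 1 -> 0 <= y <= 1 ->
    `|phi y - phi x| <= e + C * (y - x) ^+ 2.
Proof.
move=> cphi e e0.
have e2 : 0 < e / 2 by rewrite divr_gt0.
have [B HB] : exists B : R, forall y, 0 <= y <= 1 -> `|phi y| <= B.
  have cw : {within `[0, 1], continuous phi} by exact: continuous_subspaceT.
  have /compact_bounded[B [_ HB]] := continuous_compact cw (@segment_compact R 0 1).
  exists (B + 1) => y y01; apply: HB; first by rewrite ltrDl.
  by exists y => //=; rewrite in_itv.
have : \forall d \near 0^'+, `[0:R, 1:R] `<=`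
    [set x | forall y, `|x - y| < d -> `|phi x - phi y| < e].
  have /compact_near_coveringP cov := @segment_compact R 0 1.
  apply: (cov R (0^'+) (fun d x => forall y, `|x - y| < d -> `|phi x - phi y| < e)).
  move=> x _.
  have /cvgrPdist_lt/(_ _ e2) := cphi x.
  move/nbhs_ballP => [r /= r0 Hr].
  have r2 : 0 < r / 2 by rewrite divr_gt0.
  exists (ball x (r / 2), [set d | d < r / 2]) => /=.
    split; first exact: nbhsx_ballx.
    exact: nbhs_right_lt.
  move=> [x' d] /= [x'x dr] y x'y.
  have x'x' : `|x - x'| < r / 2 := x'x.
  have dr' : d < r / 2 := dr.
  have r2r : (r / 2 < r :> R) by move: (r0 : 0 < r :> R) => ?; lra.
  have xyr : (`|x - x'| + `|x' - y| < r :> R) by lra.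
  have h1 : `|phi x - phi x'| < e / 2.
    by apply: Hr; exact: lt_trans x'x' r2r.
  have h2 : `|phi x - phi y| < e / 2.
    by apply: Hr; exact: le_lt_trans (ler_distD x' x y) xyr.
  have := ler_distD (phi x) (phi x') (phi y); rewrite (distrC (phi x') (phi x)); lra.
move=> H.
have [d [d0 Hd]] : exists d : R, 0 < d /\ `[0:R, 1:R] `<=`
    [set x | forall y, `|x - y| < d -> `|phi x - phi y| < e].
  near (0:R)^'+ => d; exists d; split => //.
  by near: d.
have B0 : 0 <= B by apply: le_trans (HB 0 _); rewrite ?normr_ge0 ?lexx ?ler01.
exists (2 * B / d ^+ 2); split; first by apply: divr_ge0; [exact: mulr_ge0|exact: sqr_ge0].
move=> x y x01 y01.
have [xyd|dxy] := ltP `|y - x| d.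
  have : `|phi y - phi x| < e by apply: Hd => //=; rewrite in_itv.
  have : 0 <= 2 * B / d ^+ 2 * (y - x) ^+ 2.
    by apply: mulr_ge0; [apply: divr_ge0; [exact: mulr_ge0|exact: sqr_ge0]|exact: sqr_ge0].
  lra.
apply: (@le_trans _ _ (2 * B)).
  by apply: le_trans (ler_normB _ _) _; have := HB _ x01; have := HB _ y01; lra.
have hd : d ^+ 2 <= (y - x) ^+ 2.
  by rewrite -[leRHS]real_normK ?num_real// lerXn2r ?nnegrE ?(ltW d0).
apply: (@le_trans _ _ (2 * B / d ^+ 2 * (y - x) ^+ 2)); last by rewrite lerDr ltW.
rewrite -(mulrA (2 * B)); apply: ler_peMr; first exact: mulr_ge0.
by rewrite mulrC ler_pdivlMr ?exprn_gt0// mul1r.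
Unshelve. all: by end_near. Qed.

Lemma bern_approx (phi : R -> R) : continuous phi -> forall e : R, 0 < e ->
  exists n, forall x, 0 <= x <= 1 ->
    `|phi x - bern n (fun k => phi (k%:R / n%:R)) x| <= e.
Proof.
move=> cphi e e0; have e2 : 0 < e / 2 by rewrite divr_gt0.
have [C [C0 HC]] := uniform_modulus cphi e2.
(* The variance contributes [C * x * (1 - x) / n], which this [n] brings below [e / 2]. *)
pose n := (Num.truncn (C / (e / 2))).+1.
exists n => x x01; have n0 : 0 < n%:R :> R by rewrite ltr0n.
have Cn : C / n%:R <= e / 2.
  rewrite ler_pdivrMr// mulrC -ler_pdivrMr//.
  by rewrite ltW// truncnS_gt.
have key : bern n (fun k => e / 2 + C / n%:R ^+ 2 * (k%:R - n%:R * x) ^+ 2) x <= e.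
  rewrite bernD bern_cst bernZ bern_variance.
  have -> : C / n%:R ^+ 2 * (n%:R * x * (1 - x)) = C / n%:R * (x * (1 - x)) by field;
    rewrite gt_eqF.
  have : C / n%:R * (x * (1 - x)) <= C / n%:R * 1.
    by rewrite ler_wpM2l ?divr_ge0// ?ler0n//; case/andP: x01 => ? ?; nra.
  lra.
have Hk k : (k <= n)%N -> `|phi (k%:R / n%:R) - phi x| <=
    e / 2 + C / n%:R ^+ 2 * (k%:R - n%:R * x) ^+ 2.
  move=> kn; have := HC x (k%:R / n%:R) x01.
  have -> : C * (k%:R / n%:R - x) ^+ 2 = C / n%:R ^+ 2 * (k%:R - n%:R * x) ^+ 2.
    by field; rewrite gt_eqF.
  by apply; rewrite divr_ge0 ?ler0n//= ler_pdivrMr// mul1r ler_nat.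
rewrite ler_norml; apply/andP; split.
  rewrite -subr_ge0.
  have : bern n (fun k => phi (k%:R / n%:R)) x <=
      bern n (fun k => phi x + (e / 2 + C / n%:R ^+ 2 * (k%:R - n%:R * x) ^+ 2)) x.
    by apply: le_bern => // k /Hk; rewrite ler_norml; lra.
  rewrite bernD bern_cst; lra.
have : bern n (fun k => phi x) x <=
    bern n (fun k => phi (k%:R / n%:R) + (e / 2 + C / n%:R ^+ 2 * (k%:R - n%:R * x) ^+ 2)) x.
  by apply: le_bern => // k /Hk; rewrite ler_norml; lra.
rewrite bernD bern_cst; lra.
Qed.

End Bernstein.

(** * Trigonometric polynomials, almost periodic functions and their means *)

Section AlmostPeriodic.
Context {R : realType}.
Implicit Types f g x : R -> R.

(** Real trigonometric polynomials. The phase [be] covers sines and constants, and makes the class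
    closed under products by the product-to-sum formula. *)
Inductive trigpoly : (R -> R) -> Prop :=
| trigpoly_cos c al be : trigpoly (fun t => c * cos (al * t + be))
| trigpolyD f g : trigpoly f -> trigpoly g -> trigpoly (fun t => f t + g t).

Lemma trigpoly_cst c : trigpoly (fun=> c).
Proof.
have -> : (fun=> c) = (fun t : R => c * cos (0 * t + 0)).
  by apply/funext => t; rewrite mul0r addr0 cos0 mulr1.
exact: trigpoly_cos.
Qed.

Lemma trigpolyZ c f : trigpoly f -> trigpoly (fun t => c * f t).
Proof.
elim=> [d al be|g h _ IHg _ IHh].
  under eq_fun do rewrite mulrA.
  exact: trigpoly_cos.
under eq_fun do rewrite mulrDr.
exact: trigpolyD.
Qed.

Lemma trigpolyM f g : trigpoly f -> trigpoly g -> trigpoly (fun t => f t * g t).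
Proof.
elim=> [c al be|f1 f2 _ IH1 _ IH2] hg; last first.
  by under eq_fun do rewrite mulrDl; apply: trigpolyD; [exact: IH1|exact: IH2].
elim: hg => [d al' be'|g1 g2 _ IH1 _ IH2]; last first.
  by under eq_fun do rewrite mulrDr; exact: trigpolyD.
have -> : (fun t => c * cos (al * t + be) * (d * cos (al' * t + be'))) =
    (fun t => (c * d / 2) * cos ((al + al') * t + (be + be')) +
              (c * d / 2) * cos ((al - al') * t + (be - be'))).
  apply/funext => t.
  have -> : (al + al') * t + (be + be') = (al * t + be) + (al' * t + be') by ring.
  have -> : (al - al') * t + (be - be') = (al * t + be) - (al' * t + be') by ring.
  by rewrite (cosD (al * t + be)) (cosB (al * t + be)); field.
by apply: trigpolyD; exact: trigpoly_cos.
Qed.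

Lemma trigpoly_sum (I : Type) (s : seq I) (F : I -> R -> R) :
  (forall i, trigpoly (F i)) -> trigpoly (fun t => \sum_(i <- s) F i t).
Proof.
move=> hF; elim: s => [|i s IH].
  by under eq_fun do rewrite big_nil; exact: trigpoly_cst.
by under eq_fun do rewrite big_cons; exact: trigpolyD.
Qed.

Lemma trigpoly_bern n (F : nat -> R) x : trigpoly x ->
  trigpoly (fun t => bern n F (x t)).
Proof.
move=> hx; elim: n F => [|n IH] F /=; first exact: trigpoly_cst.
apply: trigpolyD; apply: trigpolyM => //.
apply: trigpolyD; first exact: trigpoly_cst.
under eq_fun do rewrite -mulN1r.
exact: trigpolyZ.
Qed.

Lemma trigpoly_continuous f : trigpoly f -> continuous f.
Proof.
elim=> [c al be|g h _ IHg _ IHh] t; last by apply: cvgD; [exact: IHg|exact: IHh].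
apply: cvgMr; apply: (@continuous_comp _ _ _ (fun t => al * t + be)); last exact: continuous_cos.
by apply: cvgD; [apply: cvgMr|exact: cvg_cst].
Qed.

Lemma trigpoly_bounded f : trigpoly f -> exists2 M : R, 0 < M & forall t, `|f t| <= M.
Proof.
elim=> [c al be|g h _ [M M0 HM] _ [N N0 HN]].
  exists (`|c| + 1) => [|t]; first by rewrite ltr_pwDr.
  rewrite normrM; apply: (@le_trans _ _ (`|c| * 1)); last by rewrite mulr1 lerDl.
  by apply: ler_wpM2l => //; exact: cos_max.
exists (M + N) => [|t]; first exact: addr_gt0.
by apply: le_trans (ler_normD _ _) _; exact: lerD.
Qed.

(** A translation changes only the phases of the cosines, and the mean sees only the terms of
    frequency 0. *)
Lemma trigpoly_mean f : trigpoly f ->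
  exists m, forall s, has_mean (fun t => f (t + s)) m.
Proof.
elim=> [c al be|g h tg [m Hm] th [n Hn]]; last first.
  exists (m + n) => s; apply: has_meanD => //.
  - move=> t; apply: (@continuous_comp _ _ _ (fun t => t + s)); last exact: trigpoly_continuous.
    by apply: cvgD; [exact: cvg_id|exact: cvg_cst].
  - move=> t; apply: (@continuous_comp _ _ _ (fun t => t + s)); last exact: trigpoly_continuous.
    by apply: cvgD; [exact: cvg_id|exact: cvg_cst].
have [->|al0] := eqVneq al 0.
  by exists (c * cos be) => s; under eq_fun do rewrite mul0r add0r; exact: has_mean_cst.
exists 0 => s; under eq_fun do rewrite mulrDr -addrA.
suff : has_mean (fun t : R => c * cos (al * t + (al * s + be))) (c * 0) by rewrite mulr0.
apply: has_meanZ; last exact: has_mean_cos.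
have tc : trigpoly (fun t => 1 * cos (al * t + (al * s + be))) by exact: trigpoly_cos.
by move: (trigpoly_continuous tc); under eq_fun do rewrite mul1r.
Qed.

(** Almost periodicity in the sense of Bohr, in its characterisation by uniform approximation. *)
Definition almost_periodic f : Prop := continuous f /\
  forall e : R, 0 < e -> exists2 g, trigpoly g & forall t, `|f t - g t| <= e.

Lemma almost_periodic_mean f : almost_periodic f -> exists m, has_mean f m.
Proof.
move=> [cf H]; apply: cauchy_mean => // e /H[g tg fg].
have [m Hm] := trigpoly_mean tg; exists g, m; split => //.
  exact: trigpoly_continuous.
by move: (Hm 0); under eq_fun do rewrite addr0.
Qed.

Lemma continuous_shift f s : continuous f -> continuous (fun t => f (t + s)).
Proof.
move=> cf t; apply: (@continuous_comp _ _ _ (fun t => t + s)); last exact: cf.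
by apply: cvgD; [exact: cvg_id|exact: cvg_cst].
Qed.

(** An approximating trigonometric polynomial and its translate have the same mean, and the means of
    [f] and of its translate are both close to it. *)
Lemma has_mean_shift f m s : almost_periodic f -> has_mean f m ->
  has_mean (fun t => f (t + s)) m.
Proof.
move=> [cf H] fm.
have cfs := @continuous_shift f s cf.
have [m' Hm'] : exists m', has_mean (fun t => f (t + s)) m'.
  apply: cauchy_mean => // e /H[g tg fg].
  have [n Hn] := trigpoly_mean tg; exists (fun t => g (t + s)), n; split => //.
  exact/continuous_shift/trigpoly_continuous.
suff -> : m = m' by [].
apply/eqP; rewrite -subr_eq0 -normr_le0; apply/ler_addgt0Pr => e e0; rewrite add0r.
have e2 : 0 < e / 2 by rewrite divr_gt0.
have [g tg fg] := H _ e2.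
have [n Hn] := trigpoly_mean tg.
have cg := trigpoly_continuous tg.
have Hn0 : has_mean g n by move: (Hn 0); under eq_fun do rewrite addr0.
have close f1 g1 a b : continuous f1 -> continuous g1 -> has_mean f1 a -> has_mean g1 b ->
    (forall t, `|f1 t - g1 t| <= e / 2) -> `|a - b| <= e / 2.
  move=> cf1 cg1 ha hb h.
  have cst_c : continuous (fun _ : R => e / 2) by move=> ?; exact: cvg_cst.
  have : a <= b + e / 2.
    apply: (le_has_mean (f := f1) (g := fun t => g1 t + e / 2)) => //.
    - by move=> t; apply: cvgD; [exact: cg1|exact: cvg_cst].
    - by move=> t; have := h t; rewrite ler_norml; lra.
    - by apply: has_meanD => //; exact: has_mean_cst.
  have : b <= a + e / 2.
    apply: (le_has_mean (f := g1) (g := fun t => f1 t + e / 2)) => //.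
    - by move=> t; apply: cvgD; [exact: cf1|exact: cvg_cst].
    - by move=> t; have := h t; rewrite ler_norml; lra.
    - by apply: has_meanD => //; exact: has_mean_cst.
  by rewrite ler_norml; lra.
have h1 : `|m - n| <= e / 2 by exact: (close f g).
have h2 : `|m' - n| <= e / 2.
  apply: (close (fun t => f (t + s)) (fun t => g (t + s))) => //.
  exact: continuous_shift.
by have := ler_distD n m m'; rewrite (distrC n m'); lra.
Qed.

(** A polynomial in a trigonometric polynomial is again one. Since [x] is bounded, an affine change
    of variable brings it into the unit interval, where Bernstein polynomials approximate [phi]. *)
Lemma almost_periodic_comp (phi : R -> R) x : continuous phi -> trigpoly x ->
  almost_periodic (fun t => phi (x t)).
Proof.
move=> cphi tx; split.
  by move=> t; apply: continuous_comp; [exact: trigpoly_continuous|exact: cphi].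
move=> e e0.
have [M M0 HM] := trigpoly_bounded tx.
pose y t := (x t + M) / (2 * M).
have ty : trigpoly y.
  rewrite /y; under eq_fun do rewrite mulrC.
  by apply/trigpolyZ/trigpolyD => //; exact: trigpoly_cst.
have y01 t : 0 <= y t <= 1.
  have := HM t; rewrite ler_norml => /andP[h1 h2].
  by rewrite divr_ge0 ?mulr_ge0//= ?ler_pdivrMr ?mulr_gt0//; lra.
pose psi z := phi (2 * M * z - M).
have cpsi : continuous psi.
  move=> z; apply: (@continuous_comp _ _ _ (fun z => 2 * M * z - M)); last exact: cphi.
  by apply: cvgB; [apply: cvgMr|exact: cvg_cst].
have [n Hn] := bern_approx cpsi e0.
exists (fun t => bern n (fun k => psi (k%:R / n%:R)) (y t)); first exact: trigpoly_bern.
move=> t; have := Hn _ (y01 t).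
suff -> : psi (y t) = phi (x t) by [].
by rewrite /psi; congr phi; rewrite /y; field; rewrite gt_eqF.
Qed.

End AlmostPeriodic.

(** * Elementary inequalities for powers and exponentials *)

Section RealInequalities.
Context {R : realType}.
Implicit Types x y s p : R.

(** Weighted arithmetic-geometric mean for [y] and 1: [ln z <= z - 1] is used at [y / L] and
    [1 / L], and with weights [s] and [1 - s] the right-hand sides cancel. *)
Lemma powR_bernoulli y s : 0 <= y -> 0 < s <= 1 -> y `^ s <= 1 + s * (y - 1).
Proof.
move=> y0 /andP[s0 s1].
have [->|yn0] := eqVneq y 0; first by rewrite powR0 ?gt_eqF//; lra.
have {yn0}y0 : 0 < y by rewrite lt_neqAle eq_sym yn0.
set L := 1 + s * (y - 1).
have L0 : 0 < L by rewrite /L; nra.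
rewrite -[leRHS]lnK ?posrE// /powR gt_eqF// ler_expR.
have lnB (z : R) : 0 < z -> ln z <= z - 1.
  by move=> z0; have := expR_ge1Dx (ln z); rewrite lnK ?posrE//; lra.
have h1 := lnB (y / L) (divr_gt0 y0 L0).
have h2 := lnB (1 / L) (divr_gt0 (@ltr01 R) L0).
rewrite ln_div ?posrE// in h1; rewrite ln_div ?posrE// ln1 in h2.
have e : s * (y / L - 1) + (1 - s) * (1 / L - 1) = 0.
  by rewrite /L; field; rewrite -/L gt_eqF.
have : s * (ln y - ln L) <= s * (y / L - 1) by rewrite ler_wpM2l// ltW.
have : (1 - s) * (0 - ln L) <= (1 - s) * (1 / L - 1) by rewrite ler_wpM2l// subr_ge0.
lra.
Qed.

Lemma powR_tangent u p : 0 <= u -> 1 <= p -> 1 + p * (u - 1) <= u `^ p.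
Proof.
move=> u0 p1; have p0 : 0 < p by lra.
have h := @powR_bernoulli (u `^ p) p^-1 (powR_ge0 _ _).
rewrite -powRrM mulfV ?gt_eqF// powRr1// in h.
have {}h := h (ltac:(rewrite invr_gt0 p0 invf_le1//)).
have : p * u <= p * (1 + p^-1 * (u `^ p - 1)) by rewrite ler_wpM2l// ltW.
rewrite mulrDr mulr1 mulVKf ?gt_eqF//; lra.
Qed.

(** After division by the mean [m], both points lie above the tangent at 1, and the tangent values
    average to 1. *)
Lemma powR_convex u v s p : 0 <= u -> 0 <= v -> 0 <= s <= 1 -> 1 <= p ->
  (s * u + (1 - s) * v) `^ p <= s * u `^ p + (1 - s) * v `^ p.
Proof.
move=> u0 v0 /andP[s0 s1] p1; have p0 : 0 < p by lra.
set m := s * u + (1 - s) * v.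
have m0 : 0 <= m by rewrite addr_ge0 ?mulr_ge0 ?subr_ge0.
have [me0|mn0] := eqVneq m 0.
  by rewrite me0 powR0 ?gt_eqF// addr_ge0 ?mulr_ge0 ?subr_ge0 ?powR_ge0.
have {m0 mn0}m0 : 0 < m by rewrite lt_neqAle eq_sym mn0.
have hz (z : R) : 0 <= z -> z `^ p = m `^ p * (z / m) `^ p.
  move=> z0; rewrite -powRM ?divr_ge0 ?(ltW m0)//.
  by congr (_ `^ _); field; rewrite gt_eqF.
rewrite (hz u)// (hz v)//.
have -> : s * (m `^ p * (u / m) `^ p) + (1 - s) * (m `^ p * (v / m) `^ p) =
   m `^ p * (s * (u / m) `^ p + (1 - s) * (v / m) `^ p) by ring.
rewrite ler_peMr ?powR_ge0//.
have h1 := @powR_tangent (u / m) p (divr_ge0 u0 (ltW m0)) p1.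
have h2 := @powR_tangent (v / m) p (divr_ge0 v0 (ltW m0)) p1.
have e : s * (1 + p * (u / m - 1)) + (1 - s) * (1 + p * (v / m - 1)) = 1.
  have e1 : s * (u / m) + (1 - s) * (v / m) = 1.
    by rewrite !mulrA -mulrDl divff// gt_eqF.
  have -> : s * (1 + p * (u / m - 1)) + (1 - s) * (1 + p * (v / m - 1)) =
    1 - p + p * (s * (u / m) + (1 - s) * (v / m)) by ring.
  by rewrite e1; ring.
have := ler_wpM2l s0 h1.
have := @ler_wpM2l _ (1 - s) (ltac:(rewrite subr_ge0//)) _ _ h2.
lra.
Qed.

Lemma powR_le_expR x p : 0 <= x -> 0 < p -> x `^ p <= p `^ p * expR x.
Proof.
move=> x0 p0.
have -> : x `^ p = p `^ p * (x / p) `^ p.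
  rewrite -powRM ?divr_ge0 ?(ltW p0)//.
  by congr (_ `^ _); field; rewrite gt_eqF.
rewrite ler_wpM2l ?powR_ge0//.
have -> : expR x = expR (x / p) `^ p.
  by rewrite -expRM; congr expR; field; rewrite gt_eqF.
apply: ge0_ler_powR; rewrite ?nnegrE ?expR_ge0 ?divr_ge0 ?(ltW p0)//.
by apply: le_trans (expR_ge1Dx _); rewrite lerDr.
Qed.

(** The range comes from [(1 - z) * (1 + z + 2 * z^2) = 1 + z^2 * (1 - 2 * z)], which is at least 1
    for [z <= 1/2]. The linear terms cancel in the sum, which leaves the sub-Gaussian bound. *)
Lemma cosh_le x : `|x| <= 2^-1 -> (expR x + expR (- x)) / 2 <= expR (2 * x ^+ 2).
Proof.
move=> hx.
have key (z : R) : `|z| <= 2^-1 -> expR z <= 1 + z + 2 * z ^+ 2.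
  rewrite ler_norml => /andP[z1 z2].
  have h : expR z * (1 - z) <= 1.
    have := expR_ge1Dx (- z); rewrite -(ler_pM2l (expR_gt0 z)) -expRD subrr expR0; lra.
  have : expR z <= (1 - z)^-1 by rewrite -[leRHS]mul1r ler_pdivlMr//; lra.
  move/le_trans; apply; rewrite -[leLHS]mul1r ler_pdivrMr; [nra|lra].
have h1 := key _ hx.
have h2 : expR (- x) <= 1 + (- x) + 2 * (- x) ^+ 2 by apply: key; rewrite normrN.
apply: le_trans (expR_ge1Dx _); rewrite sqrrN in h2; lra.
Qed.

Lemma continuous_norm_powR p : 0 < p -> continuous (fun x => `|x| `^ p).
Proof.
move=> p0 x.
have [->|x0] := eqVneq x 0.
  rewrite /continuous_at normr0 powR0 ?gt_eqF//.
  apply/cvgr0Pnorm_le => e e0.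
  near=> y; rewrite ger0_norm ?powR_ge0//.
  have -> : e = (e `^ p^-1) `^ p by rewrite -powRrM mulVf ?gt_eqF// powRr1// ltW.
  apply: ge0_ler_powR; rewrite ?nnegrE ?powR_ge0 ?(ltW p0)//.
  near: y.
  have : 0 < e `^ p^-1 by rewrite powR_gt0.
  move=> d0; exists (e `^ p^-1) => //= y; rewrite /ball_/= sub0r normrN.
  exact: ltW.
apply: (@continuous_comp _ _ _ (fun x => `|x|) (fun y => y `^ p)); first exact: norm_continuous.
apply/differentiable_continuous/derivable1_diffP/derivable_powR.
by rewrite in_itv/= andbT normr_gt0.
Unshelve. all: by end_near. Qed.

End RealInequalities.

(** * Complex moduli and the unit circle *)

Section Complex.
Context {R : realType}.
Local Open Scope complex_scope.
Local Notation nc := (@ComplexField.Normc.normc R).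
Implicit Types (z w : R[i]) (x y : R).

Definition cis x : R[i] := cos x +i* sin x.

Lemma cisD x y : cis (x + y) = cis x * cis y.
Proof. by rewrite /cis cosD sinD; apply/eqP; rewrite eq_complex /=; apply/andP; split;
  apply/eqP; ring. Qed.

Lemma normc_cis x : nc (cis x) = 1.
Proof. by rewrite /cis /= cos2Dsin2 sqrtr1. Qed.

Lemma normc_ge0 z : 0 <= nc z.
Proof. by case: z => a b; exact: sqrtr_ge0. Qed.

Lemma normcD z w : nc (z + w) <= nc z + nc w.
Proof. exact: le_normcD. Qed.

Lemma normcB z w : nc (z - w) = nc (w - z).
Proof. by rewrite -opprB normcN. Qed.

Lemma normc_real x : nc x%:C = `|x|.
Proof. by rewrite /= expr0n/= addr0 sqrtr_sqr. Qed.

Lemma normc_sqr z : nc z ^+ 2 = complex.Re z ^+ 2 + complex.Im z ^+ 2.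
Proof. by case: z => a b /=; rewrite sqr_sqrtr// addr_ge0 ?sqr_ge0. Qed.

Lemma dist_normc_le z w : `|nc z - nc w| <= nc (z - w).
Proof.
have h1 := normcD w (z - w); have h2 := normcD z (w - z).
rewrite subrKC in h1; rewrite subrKC (normcB w) in h2.
by rewrite ler_norml; lra.
Qed.

Lemma Re_le_normc z : `|complex.Re z| <= nc z.
Proof.
case: z => a b /=; rewrite -sqrtr_sqr ler_sqrt ?addr_ge0 ?sqr_ge0//.
by rewrite lerDl sqr_ge0.
Qed.

Lemma Im_le_normc z : `|complex.Im z| <= nc z.
Proof.
case: z => a b /=; rewrite -sqrtr_sqr ler_sqrt ?addr_ge0 ?sqr_ge0//.
by rewrite lerDr sqr_ge0.
Qed.

Lemma normc_le_ReIm z : nc z <= `|complex.Re z| + `|complex.Im z|.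
Proof.
rewrite -(@ler_pXn2r _ 2)// ?nnegrE ?normc_ge0 ?addr_ge0//.
rewrite normc_sqr sqrrD -[X in X + _ <= _]real_normK ?num_real//.
rewrite -[X in _ + X <= _]real_normK ?num_real//.
by rewrite -addrA [_ *+ 2 + _]addrC addrA lerDl mulrn_wge0// mulr_ge0.
Qed.

Lemma normc_sum (I : Type) (s : seq I) (P : pred I) (F : I -> R[i]) :
  nc (\sum_(i <- s | P i) F i) <= \sum_(i <- s | P i) nc (F i).
Proof.
elim/big_ind2 : _ => [|z x w y zx wy|//]; first by rewrite ComplexField.Normc.normc0.
by apply: le_trans (normcD _ _) _; exact: lerD.
Qed.

Lemma normc_polar z : exists2 c : R[i], nc c = 1 & c * z = (nc z)%:C.
Proof.
have [->|z0] := eqVneq z 0.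
  by exists 1; rewrite ?ComplexField.Normc.normc1// ComplexField.Normc.normc0 mulr0.
have n0 : nc z != 0 by apply: contra z0 => /eqP/ComplexField.Normc.eq0_normc ->.
exists ((nc z)%:C / z).
  by rewrite ComplexField.Normc.normcM ComplexField.Normc.normcV normc_real ger0_norm
    ?normc_ge0// divff.
by rewrite divfK.
Qed.

End Complex.

(** * Norms of Dirichlet polynomials *)

Section PolynomialNorm.
Context {R : realType} (lam : nat -> R).
Local Open Scope complex_scope.
Local Notation nc := (@ComplexField.Normc.normc R).
Implicit Types (a b : nat -> R[i]) (N : nat) (p q : R).

Definition supp_lt N a := forall n, (N <= n)%N -> a n = 0.

Definition ev N a (t : R) : R[i] := \sum_(i < N) a i * cis (- (lam i * t)).

Lemma deval_ev N a t : supp_lt N a -> deval lam a (0 +i* t) = ev N a t.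
Proof.
move=> aN; rewrite /deval -(@fsbig_widen _ _ _ _ `I_N); last 2 first.
- by [].
- move=> n [_ /= /negP]; rewrite -leqNgt => Nn.
  by rewrite /dterm aN// mul0r.
rewrite -fsbig_ord; apply: eq_bigr => i _; rewrite /dterm; congr (_ * _).
rewrite /cexp /= !(mulr0, mul0r, oppr0, subr0, addr0) expR0.
rewrite /cis !mulNr; apply/eqP; rewrite eq_complex /=; apply/andP.
by split; apply/eqP; rewrite !(mul1r, mul0r, subr0, addr0).
Qed.

Lemma supp_ltW N N' a : (N <= N')%N -> supp_lt N a -> supp_lt N' a.
Proof. by move=> NN' aN n N'n; apply: aN; exact: leq_trans N'n. Qed.


Lemma evD N a b t : ev N (fun n => a n + b n) t = ev N a t + ev N b t.
Proof. by rewrite /ev -big_split/=; apply: eq_bigr => i _; rewrite mulrDl. Qed.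

Lemma evZ N c a t : ev N (fun n => c * a n) t = c * ev N a t.
Proof. by rewrite /ev mulr_sumr; apply: eq_bigr => i _; rewrite mulrA. Qed.

Lemma ev_le N a t : nc (ev N a t) <= \sum_(i < N) nc (a i).
Proof.
apply: le_trans (normc_sum _ _ _) _; apply: ler_sum => i _.
by rewrite ComplexField.Normc.normcM normc_cis mulr1.
Qed.

Lemma trigpoly_Re_ev N a : trigpoly (fun t => complex.Re (ev N a t)).
Proof.
rewrite /ev; under eq_fun do rewrite raddf_sum.
apply: trigpoly_sum => i.
have -> : (fun t => complex.Re (a i * cis (- (lam i * t)))) =
    (fun t => complex.Re (a i) * cos (lam i * t + 0) +
              complex.Im (a i) * cos (lam i * t + (- (pi / 2)))).
  apply/funext => t; rewrite addr0 cosBpihalf.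
  by case: (a i) => u v; rewrite /cis/= cosN sinN; ring.
by apply: trigpolyD; exact: trigpoly_cos.
Qed.

Lemma trigpoly_Im_ev N a : trigpoly (fun t => complex.Im (ev N a t)).
Proof.
rewrite /ev; under eq_fun do rewrite raddf_sum.
apply: trigpoly_sum => i.
have -> : (fun t => complex.Im (a i * cis (- (lam i * t)))) =
    (fun t => complex.Im (a i) * cos (lam i * t + 0) +
              - complex.Re (a i) * cos (lam i * t + (- (pi / 2)))).
  apply/funext => t; rewrite addr0 cosBpihalf.
  by case: (a i) => u v; rewrite /cis/= cosN sinN; ring.
by apply: trigpolyD; exact: trigpoly_cos.
Qed.

Lemma trigpoly_normc_sqr N a : trigpoly (fun t => nc (ev N a t) ^+ 2).
Proof.
under eq_fun do rewrite normc_sqr !expr2.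
by apply: trigpolyD; apply: trigpolyM;
  (exact: trigpoly_Re_ev || exact: trigpoly_Im_ev).
Qed.

(** The modulus of a Dirichlet polynomial is not a trigonometric polynomial, but its square is; the
    power is therefore read as a continuous function of the square. *)
Lemma normc_powRE p z : nc z `^ p = `|nc z ^+ 2| `^ (p / 2).
Proof.
rewrite ger0_norm ?sqr_ge0// -powR_mulrn ?normc_ge0// -powRrM.
by congr (_ `^ _); rewrite mulrC divfK.
Qed.

Lemma almost_periodic_ev N a p : 0 < p ->
  almost_periodic (fun t => nc (ev N a t) `^ p).
Proof.
move=> p0; under eq_fun do rewrite normc_powRE.
apply: (almost_periodic_comp (phi := fun x => `|x| `^ (p / 2))); last exact: trigpoly_normc_sqr.
by apply: continuous_norm_powR; rewrite divr_gt0.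
Qed.

Lemma continuous_ev N a p : 0 < p -> continuous (fun t => nc (ev N a t) `^ p).
Proof. by move=> p0; have [] := @almost_periodic_ev N a p p0. Qed.

(** Turns the [lim] in [dnorm] into an actual limit. All later facts about the norm go through
    means. *)
Lemma dnorm_has_mean N a p : 0 < p -> supp_lt N a ->
  has_mean (fun t => nc (ev N a t) `^ p) (dnorm lam p a `^ p) /\ 0 <= dnorm lam p a.
Proof.
move=> p0 aN.
have cev := @continuous_ev N a p p0.
have [m Hm] := almost_periodic_mean (@almost_periodic_ev N a p p0).
have m0 : 0 <= m.
  apply: (le_has_mean (f := fun=> 0) (g := fun t => nc (ev N a t) `^ p)) => //.
  - by move=> ?; exact: cvg_cst.
  - by move=> t; exact: powR_ge0.
  - exact: has_mean_cst.
suff -> : dnorm lam p a = m `^ p^-1.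
  by rewrite -powRrM mulVf ?gt_eqF// powRr1//; split => //; exact: powR_ge0.
have E : (fun t => nc (deval lam a (0 +i* t)) `^ p) = (fun t => nc (ev N a t) `^ p).
  by apply/funext => t; rewrite (deval_ev t aN).
rewrite /dnorm E; apply/cvg_lim => //.
have -> : m `^ p^-1 = `|m| `^ p^-1 by rewrite ger0_norm.
have H : `|avg (fun t => nc (ev N a t) `^ p) T| `^ p^-1 @[T --> +oo] --> `|m| `^ p^-1.
  have pV0 : 0 < p^-1 by rewrite invr_gt0.
  exact: (cvg_comp _ _ Hm (continuous_norm_powR pV0 (x := m))).
apply: cvg_trans H; apply: near_eq_cvg; near=> T.
have T0 : 0 < T by [].
rewrite /= ger0_norm; last first.
  by rewrite /avg mulr_ge0 ?invr_ge0 ?mulr_ge0 ?(ltW T0)// Rintegral_ge0// => t _; exact: powR_ge0.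
by [].
Unshelve. all: by end_near. Qed.

(* Existential so that the norm becomes a variable, which [lra] does not compute. *)
Lemma dnormE N a p : 0 < p -> supp_lt N a -> exists x : R,
  [/\ dnorm lam p a = x, has_mean (fun t => nc (ev N a t) `^ p) (x `^ p) & 0 <= x].
Proof. by move=> p0 aN; have [? ?] := dnorm_has_mean p0 aN; exists (dnorm lam p a). Qed.

Lemma dnorm_ge0 N a p : 0 < p -> supp_lt N a -> 0 <= dnorm lam p a.
Proof. by move=> p0 aN; have [] := dnorm_has_mean p0 aN. Qed.

Lemma dnorm_le N a p C : 1 <= p -> supp_lt N a -> 0 <= C ->
  (forall m, has_mean (fun t => nc (ev N a t) `^ p) m -> m <= C `^ p) ->
  dnorm lam p a <= C.
Proof.
move=> p1 aN C0 H; have p0 : 0 < p by lra.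
have [x [-> /H h h0]] := dnormE p0 aN.
rewrite leNgt; apply/negP => Ca; move: h; apply/negP; rewrite -ltNge.
by apply: gt0_ltr_powR; rewrite ?nnegrE.
Qed.

Lemma dnorm_le_l1 N a p : 1 <= p -> supp_lt N a ->
  dnorm lam p a <= \sum_(i < N) nc (a i).
Proof.
move=> p1 aN; have p0 : 0 < p by lra.
have S0 : 0 <= \sum_(i < N) nc (a i) by apply: sumr_ge0 => i _; exact: normc_ge0.
apply: (dnorm_le p1 aN) => // m Hm.
apply: (le_has_mean (f := fun t => nc (ev N a t) `^ p)
  (g := fun=> (\sum_(i < N) nc (a i)) `^ p)) => //.
- exact: continuous_ev.
- by move=> ?; exact: cvg_cst.
- move=> t; apply: ge0_ler_powR; rewrite ?nnegrE ?(ltW p0) ?normc_ge0//.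
  exact: ev_le.
- exact: has_mean_cst.
Qed.

Lemma le_addgt0 (x y : R) : (forall e : R, 0 < e -> x <= y + e) -> x <= y.
Proof. by move=> H; apply/ler_addgt0Pr => e e0; exact: H. Qed.

(** Minkowski by convexity: for [A] and [B] just above the two norms, [|D| + |E|] is [A + B] times a
    convex combination of [|D| / A] and [|E| / B], whose p-th powers have mean at most 1. *)
Lemma dnormD N a b p : 1 <= p -> supp_lt N a -> supp_lt N b ->
  dnorm lam p (fun n => a n + b n) <= dnorm lam p a + dnorm lam p b.
Proof.
move=> p1 aN bN; have p0 : 0 < p by lra.
have [x [-> ha a0]] := dnormE p0 aN.
have [y [-> hb b0]] := dnormE p0 bN.
apply: le_addgt0 => e e0.
(* The margin keeps the divisors positive even when a norm vanishes. *)
pose A := x + e / 2; pose B := y + e / 2.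
have A0 : 0 < A by rewrite /A; lra.
have B0 : 0 < B by rewrite /B; lra.
have -> : x + y + e = A + B by rewrite /A /B; field.
have abN : supp_lt N (fun n => a n + b n) by move=> n Nn; rewrite aN ?bN ?addr0.
apply: (dnorm_le p1 abN); first by rewrite ltW// addr_gt0.
move=> m hm.
set s := A / (A + B).
have AB0 : 0 < A + B by rewrite addr_gt0.
have s01 : 0 <= s <= 1.
  by rewrite /s divr_ge0 ?(ltW A0) ?(ltW AB0)//= ler_pdivrMr// mul1r lerDl ltW.
have [s0 s1] := andP s01.
pose g t := (A + B) `^ p * (s * (A `^ p)^-1) * nc (ev N a t) `^ p +
            (A + B) `^ p * ((1 - s) * (B `^ p)^-1) * nc (ev N b t) `^ p.
have cZ (c : R) (f : R -> R) : continuous f -> continuous (fun t => c * f t).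
  by move=> cf t; apply: cvgMr; exact: cf.
have ca := cZ ((A + B) `^ p * (s * (A `^ p)^-1)) _ (@continuous_ev N a p p0).
have cb := cZ ((A + B) `^ p * ((1 - s) * (B `^ p)^-1)) _ (@continuous_ev N b p p0).
apply: (@le_trans _ _ ((A + B) `^ p * (s * (A `^ p)^-1) * x `^ p +
            (A + B) `^ p * ((1 - s) * (B `^ p)^-1) * y `^ p)).
  apply: (le_has_mean (f := fun t => nc (ev N (fun n => a n + b n) t) `^ p) (g := g)) => //.
  - exact: continuous_ev.
  - by move=> t; apply: cvgD; [exact: ca|exact: cb].
  - move=> t; rewrite evD /g.
    apply: (@le_trans _ _ ((nc (ev N a t) + nc (ev N b t)) `^ p)).
      by apply: ge0_ler_powR; rewrite ?nnegrE ?addr_ge0 ?normc_ge0 ?(ltW p0) ?normcD.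
    have -> : nc (ev N a t) + nc (ev N b t) =
        (A + B) * (s * (nc (ev N a t) / A) + (1 - s) * (nc (ev N b t) / B)).
      by rewrite /s; field; rewrite !gt_eqF.
    rewrite powRM ?(ltW AB0)//; last first.
      by apply: addr_ge0; apply: mulr_ge0; rewrite ?subr_ge0//;
        apply: divr_ge0; rewrite ?normc_ge0 ?(ltW A0) ?(ltW B0).
    apply: (@le_trans _ _ ((A + B) `^ p *
        (s * (nc (ev N a t) / A) `^ p + (1 - s) * (nc (ev N b t) / B) `^ p))).
      apply: ler_wpM2l; first exact: powR_ge0.
      by apply: powR_convex => //; apply: divr_ge0; rewrite ?normc_ge0 ?(ltW A0) ?(ltW B0).
    have Vp (z : R) : 0 < z -> z^-1 `^ p = (z `^ p)^-1.
      by move=> z0; rewrite -powR_inv1 ?ltW// -powRrM mulN1r powRN.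
    rewrite !powRM ?invr_ge0 ?normc_ge0 ?(ltW A0) ?(ltW B0)// !Vp//.
    by rewrite le_eqVlt; apply/orP; left; apply/eqP; ring.
  - by apply: (has_meanD ca cb); apply: has_meanZ => //; exact: continuous_ev.
have -> : (A + B) `^ p * (s / A `^ p) * x `^ p + (A + B) `^ p * ((1 - s) / B `^ p) * y `^ p =
    (A + B) `^ p * (s * ((A `^ p)^-1 * x `^ p) + (1 - s) * ((B `^ p)^-1 * y `^ p)) by ring.
apply: ler_piMr; first exact: powR_ge0.
have le1 (z X : R) : 0 <= z -> z <= X -> 0 < X -> (X `^ p)^-1 * z `^ p <= 1.
  move=> z0 xX X0; rewrite mulrC ler_pdivrMr ?powR_gt0// mul1r.
  by apply: ge0_ler_powR; rewrite ?nnegrE ?(ltW p0) ?(ltW X0).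
have aA : x <= A by rewrite /A lerDl; lra.
have bB : y <= B by rewrite /B lerDl; lra.
have h1 := ler_wpM2l s0 (le1 _ _ a0 aA A0).
have h2 : (1 - s) * ((B `^ p)^-1 * y `^ p) <= (1 - s) * 1.
  by apply: ler_wpM2l; [rewrite subr_ge0|exact: le1].
lra.
Qed.

Lemma dnormZ N a p c : 1 <= p -> supp_lt N a ->
  dnorm lam p (fun n => c * a n) <= nc c * dnorm lam p a.
Proof.
move=> p1 aN; have p0 : 0 < p by lra.
have [x [-> ha a0]] := dnormE p0 aN.
have caN : supp_lt N (fun n => c * a n) by move=> n Nn; rewrite aN ?mulr0.
apply: (dnorm_le p1 caN); first by rewrite mulr_ge0 ?normc_ge0.
move=> m hm; rewrite powRM ?normc_ge0//.
suff -> : m = nc c `^ p * x `^ p by [].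
apply: (has_mean_unique hm).
under eq_fun do rewrite evZ ComplexField.Normc.normcM powRM ?normc_ge0//.
by apply: has_meanZ => //; exact: continuous_ev.
Qed.

Lemma dnorm_sum N (A : nat -> nat -> R[i]) p k : 1 <= p ->
  (forall j, supp_lt N (A j)) ->
  dnorm lam p (fun n => \sum_(j < k) A j n) <= \sum_(j < k) dnorm lam p (A j).
Proof.
move=> p1 AN; elim: k => [|k IH].
  under eq_fun do rewrite big_ord0.
  apply: le_trans (@dnorm_le_l1 0 _ p p1 _) _ => //.
  by rewrite !big_ord0.
under eq_fun do rewrite big_ord_recr/=.
rewrite big_ord_recr/=; apply: le_trans (@dnormD N _ _ p p1 _ _) _ => //.
  by move=> n Nn; rewrite big1// => j _; exact: AN.
by rewrite lerD2r.
Qed.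

End PolynomialNorm.

(** * Comparison of norms in different exponents, Fourier-Bohr coefficients, Parseval *)

Section NormComparison.
Context {R : realType} (lam : nat -> R).
Local Open Scope complex_scope.
Local Notation nc := (@ComplexField.Normc.normc R).
Local Notation ev := (ev lam).
Implicit Types (a b : nat -> R[i]) (N : nat) (p q : R).

Lemma le_has_mean_affine (f g : R -> R) m n (c d : R) : continuous f -> continuous g ->
  (forall t, f t <= c + d * g t) -> has_mean f m -> has_mean g n -> m <= c + d * n.
Proof.
move=> cf cg fg hf hg.
have cdg : continuous (fun t => d * g t) by move=> t; apply: cvgMr; exact: cg.
apply: (le_has_mean (f := f) (g := fun t => c + d * g t)) => //.
  by move=> t; apply: cvgD; [exact: cvg_cst|exact: cdg].
apply: (has_meanD (f := fun=> c) (g := fun t => d * g t)) => //.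
- by move=> t; exact: cvg_cst.
- exact: has_mean_cst.
- exact: has_meanZ.
Qed.

(** Bernoulli's inequality bounds [z^p] by an affine function of [z^q], tangent at [z = C] with [C]
    just above the q-norm; an affine bound survives averaging. *)
Lemma le_dnorm N a p q : 1 <= p -> p <= q -> supp_lt N a ->
  dnorm lam p a <= dnorm lam q a.
Proof.
move=> p1 pq aN.
have p0 : 0 < p by lra.
have q0 : 0 < q by lra.
have [y [-> hy y0]] := @dnormE _ lam N a q q0 aN.
apply: le_addgt0 => e e0.
pose C := y + e.
have C0 : 0 < C by rewrite /C; lra.
apply: (dnorm_le p1 aN (C := C)); first exact: ltW.
move=> m hm.
have Cq0 : 0 < C `^ q by rewrite powR_gt0.
have pq01 : 0 < p / q <= 1 by rewrite divr_gt0//= ler_pdivrMr// mul1r.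
have F t : nc (ev N a t) `^ p <=
    C `^ p * (1 - p / q) + C `^ p * (p / q / C `^ q) * nc (ev N a t) `^ q.
  set z := nc (ev N a t).
  have z0 : 0 <= z by exact: normc_ge0.
  have h := @powR_bernoulli R ((z / C) `^ q) (p / q) (powR_ge0 _ _) pq01.
  rewrite -powRrM mulrCA divff ?gt_eqF// mulr1 in h.
  have hz r : z `^ r = C `^ r * (z / C) `^ r.
    rewrite -powRM ?divr_ge0 ?(ltW C0)//.
    by congr (_ `^ _); field; rewrite gt_eqF.
  have -> : C `^ p * (1 - p / q) + C `^ p * (p / q / C `^ q) * z `^ q =
      C `^ p * (1 + p / q * ((z / C) `^ q - 1)).
    by rewrite (hz q); field; rewrite !gt_eqF.
  by rewrite (hz p); apply: ler_wpM2l => //; exact: powR_ge0.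
have h := @le_has_mean_affine _ _ _ _ _ _
  (@continuous_ev _ lam N a p p0) (@continuous_ev _ lam N a q q0) F hm hy.
apply: (le_trans h).
have -> : C `^ p * (1 - p / q) + C `^ p * (p / q / C `^ q) * y `^ q =
   C `^ p * (1 + p / q * (y `^ q / C `^ q - 1)) by ring.
apply: ler_piMr; first exact: powR_ge0.
rewrite gerDl; apply: mulr_ge0_le0; first by case/andP: pq01 => /ltW.
rewrite subr_le0 ler_pdivrMr// mul1r.
by apply: ge0_ler_powR; rewrite ?nnegrE ?(ltW q0) ?(ltW C0) ?y0// /C lerDl ltW.
Qed.

(** Pointwise [|D|^q = |D|^(q - p) * |D|^p], and the absolute sum of the coefficients bounds the
    first factor. *)
Lemma dnorm_interpolation N a p q S : 1 <= p -> p <= q -> supp_lt N a ->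
  \sum_(i < N) nc (a i) <= S ->
  dnorm lam q a `^ q <= S `^ (q - p) * dnorm lam p a `^ p.
Proof.
move=> p1 pq aN aS.
have p0 : 0 < p by lra.
have q0 : 0 < q by lra.
have [x [-> hx x0]] := @dnormE _ lam N a p p0 aN.
have [y [-> hy y0]] := @dnormE _ lam N a q q0 aN.
have F t : nc (ev N a t) `^ q <= 0 + S `^ (q - p) * nc (ev N a t) `^ p.
  rewrite add0r; have z0 := normc_ge0 (ev N a t).
  have zS := le_trans (ev_le lam N a t) aS.
  have [->|zn0] := eqVneq (nc (ev N a t)) 0.
    by rewrite powR0 ?gt_eqF// mulr_ge0 ?powR_ge0.
  have {1}-> : q = (q - p) + p by rewrite subrK.
  rewrite powRD; last by rewrite zn0 implybT.
  apply: ler_wpM2r; first exact: powR_ge0.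
  by apply: ge0_ler_powR; rewrite ?nnegrE ?subr_ge0 ?(le_trans z0 zS).
have := @le_has_mean_affine _ _ _ _ _ _
  (@continuous_ev _ lam N a q q0) (@continuous_ev _ lam N a p p0) F hy hx.
by rewrite add0r.
Qed.

Lemma has_mean_cos_term (z : R[i]) (be : R) :
  has_mean (fun t => complex.Re (z * cis (be * t))) (if be == 0 then complex.Re z else 0).
Proof.
have E : (fun t => complex.Re (z * cis (be * t))) =
    (fun t => complex.Re z * cos (be * t + 0) + complex.Im z * cos (be * t + pi / 2)).
  by apply/funext => t; rewrite addr0 cosDpihalf; case: z => u v /=; ring.
have [be0|be0] := eqVneq be 0.
  rewrite be0; under eq_fun do rewrite mul0r /cis cos0 sin0.
  have -> : (fun=> complex.Re (z * (1 +i* 0))) = (fun=> complex.Re z) :> (R -> R).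
    by apply/funext => _; case: z {E} => u v /=; ring.
  exact: has_mean_cst.
rewrite E.
suff H : has_mean (fun t => complex.Re z * cos (be * t + 0) + complex.Im z * cos (be * t + pi / 2))
    (complex.Re z * 0 + complex.Im z * 0) by rewrite !mulr0 addr0 in H.
have cc (c ph : R) : continuous (fun t : R => c * cos (be * t + ph)).
  by apply: trigpoly_continuous; exact: trigpoly_cos.
have cc1 (ph : R) : continuous (fun t : R => cos (be * t + ph)).
  by have := cc 1 ph; under eq_fun do rewrite mul1r.
by apply: has_meanD; [exact: cc|exact: cc|..]; apply: has_meanZ;
  rewrite //; exact: has_mean_cos.
Qed.

Lemma continuous_cross N a (c : R[i]) (al : R) :
  continuous (fun t => complex.Re (c * cis (al * t) * ev N a t)).
Proof.
apply: trigpoly_continuous.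
have -> : (fun t => complex.Re (c * cis (al * t) * ev N a t)) =
  (fun t => \sum_(i < N) (complex.Re (c * a i) * cos ((al - lam i) * t + 0) +
             complex.Im (c * a i) * cos ((al - lam i) * t + pi / 2))).
  apply/funext => t; rewrite mulr_sumr raddf_sum; apply: eq_bigr => i _.
  have -> : c * cis (al * t) * (a i * cis (- (lam i * t))) =
     (c * a i) * cis ((al - lam i) * t).
    by rewrite mulrBl cisD; ring.
  by rewrite addr0 cosDpihalf; case: (c * a i) => u v /=; ring.
by apply: trigpoly_sum => i; apply: trigpolyD; exact: trigpoly_cos.
Qed.

(** The Fourier-Bohr coefficient at [al], taken as a real part because means are defined for real
    functions; the free factor [c] gives access to the other components. *)
Lemma has_mean_cross N a (c : R[i]) (al : R) :
  has_mean (fun t => complex.Re (c * cis (al * t) * ev N a t))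
    (\sum_(i < N) if lam i == al then complex.Re (c * a i) else 0).
Proof.
elim: N => [|N IH].
  rewrite big_ord0; under eq_fun do rewrite /ev big_ord0 mulr0.
  exact: has_mean_cst.
rewrite big_ord_recr/=.
have E1 t : complex.Re (c * cis (al * t) * ev N.+1 a t) =
    complex.Re (c * cis (al * t) * ev N a t) + complex.Re (c * a N * cis ((al - lam N) * t)).
  rewrite /ev big_ord_recr/= mulrDr raddfD; congr (_ + complex.Re _).
  by rewrite mulrBl cisD; ring.
under eq_fun do rewrite E1.
apply: has_meanD => //.
- exact: continuous_cross.
(* A single exponential is the case of one summand, with the frequency shifted by [lam 0] to offset
   the exponential inside [ev 1]. *)
- move=> t; have := @continuous_cross 1 (fun=> a N) c (al - lam N + lam 0%N).
  under eq_fun do rewrite /ev big_ord1/=.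
  suff -> : (fun t => complex.Re (c * cis ((al - lam N + lam 0%N) * t) * (a N * cis (- (lam 0%N
    * t))))) =
    (fun t => complex.Re (c * a N * cis ((al - lam N) * t))) by exact.
  by apply/funext => u; congr complex.Re;
    rewrite mulrDl cisD mulrACA -!mulrA -cisD subrr /cis cos0 sin0 mulr1.
- have := @has_mean_cos_term (c * a N) (al - lam N).
  by rewrite subr_eq0 eq_sym.
Qed.

Hypothesis lam_inj : injective lam.

(** Since norms increase with the exponent, [p = 1] is enough. There a unimodular [c] rotates the
    coefficient to its modulus, which is the mean of a function bounded by [|D|]. *)
Lemma coef_le_dnorm N a p n : 1 <= p -> supp_lt N a -> nc (a n) <= dnorm lam p a.
Proof.
move=> p1 aN.
have [Nn|nN] := leqP N n.
  by rewrite aN// ComplexField.Normc.normc0; apply: (@dnorm_ge0 _ lam N) => //; lra.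
apply: le_trans (@le_dnorm N a 1 p _ p1 aN) => //.
have [x [-> hx x0]] := @dnormE _ lam N a 1 ltr01 aN.
have [c c1 ca] := normc_polar (a n).
have := @has_mean_cross N a c (lam n).
have -> : \sum_(i < N) (if lam i == lam n then complex.Re (c * a i) else 0) = nc (a n).
  rewrite (bigD1 (Ordinal nN))//= eqxx big1 ?addr0 ?ca// => i /eqP ni.
  rewrite ifF//; apply/negbTE/eqP => /lam_inj /= e; apply: ni.
  exact/val_inj.
move=> hn; rewrite -[leRHS]powRr1//.
apply: (le_has_mean _ _ _ hn hx).
- exact: continuous_cross.
- exact: continuous_ev.
- move=> t; rewrite powRr1 ?normc_ge0//.
  apply: le_trans (ler_norm _) _; apply: le_trans (Re_le_normc _) _.
  by rewrite !ComplexField.Normc.normcM c1 normc_cis !mul1r.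
Qed.

(** The last term is split off; its cross product with the others has mean 0 because [lam N] differs
    from all earlier frequencies. *)
Lemma parseval N a : has_mean (fun t => nc (ev N a t) ^+ 2) (\sum_(i < N) nc (a i) ^+ 2).
Proof.
elim: N => [|N IH].
  rewrite big_ord0; under eq_fun do rewrite /ev big_ord0 ComplexField.Normc.normc0 expr0n/=.
  exact: has_mean_cst.
rewrite big_ord_recr/=.
have E t : nc (ev N.+1 a t) ^+ 2 = nc (ev N a t) ^+ 2 + (nc (a N) ^+ 2 +
    2 * complex.Re (conjc (a N) * cis (lam N * t) * ev N a t)).
  rewrite /ev big_ord_recr/=; set w := \sum_(i < N) _.
  have e1 (u v : R[i]) : nc (w + u * v) ^+ 2 = nc w ^+ 2 + (nc (u * v) ^+ 2 +
     2 * complex.Re (conjc u * conjc v * w)).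
    by rewrite !normc_sqr; case: w u v => [? ?] [? ?] [? ?] /=; ring.
  rewrite e1 ComplexField.Normc.normcM normc_cis mulr1.
  suff -> : conjc (cis (- (lam N * t))) = cis (lam N * t) by [].
  by rewrite /cis /= cosN sinN opprK.
under eq_fun do rewrite E.
apply: has_meanD => //.
- exact/trigpoly_continuous/trigpoly_normc_sqr.
- move=> t; apply: cvgD; first exact: cvg_cst.
  by apply: cvgMr; exact: continuous_cross.
- suff H : has_mean (fun t => nc (a N) ^+ 2 + 2 * complex.Re (conjc (a N) * cis (lam N * t) *
  ev N a t))
      (nc (a N) ^+ 2 + 0) by rewrite addr0 in H.
  apply: has_meanD.
  + by move=> t; exact: cvg_cst.
  + by move=> t; apply: cvgMr; exact: continuous_cross.
  + exact: has_mean_cst.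
  + suff H : has_mean (fun t => 2 * complex.Re (conjc (a N) * cis (lam N * t) * ev N a t)) (2 * 0).
      by rewrite mulr0 in H.
    apply: has_meanZ; first exact: continuous_cross.
    have := @has_mean_cross N a (conjc (a N)) (lam N).
    rewrite big1// => i _; rewrite ifF//; apply/negbTE/eqP => /lam_inj e.
    by have := ltn_ord i; rewrite e ltnn.
Qed.

Lemma dnorm2 N a : supp_lt N a -> dnorm lam 2 a ^+ 2 = \sum_(i < N) nc (a i) ^+ 2.
Proof.
move=> aN; have [x [-> hx x0]] := @dnormE _ lam N a 2 (@ltr0n _ 2) aN.
rewrite -powR_mulrn//; apply: (has_mean_unique hx).
under eq_fun do rewrite powR_mulrn ?normc_ge0//.
exact: parseval.
Qed.

End NormComparison.

(** * Gaussian multipliers as limits of powers of cosines *)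

Section GaussianMultiplier.
Context {R : realType} (lam : nat -> R).
Local Open Scope complex_scope.
Local Notation nc := (@ComplexField.Normc.normc R).
Local Notation ev := (ev lam).
Implicit Types (a b : nat -> R[i]) (N : nat) (p q : R).

(* [D(t)] is replaced by the average of [D(t - d)] and [D(t + d)], up to unimodular
   factors. *)
Lemma cos_multiplier N a p (k d : R) : 1 <= p -> supp_lt N a ->
  dnorm lam p (fun n => (cos (d * (lam n - k)))%:C * a n) <= dnorm lam p a.
Proof.
move=> p1 aN; have p0 : 0 < p by lra.
have [x [-> hx x0]] := @dnormE _ lam N a p p0 aN.
have caN : supp_lt N (fun n => (cos (d * (lam n - k)))%:C * a n).
  by move=> n Nn; rewrite aN ?mulr0.
apply: (dnorm_le p1 caN) => // m hm.
have E t : ev N (fun n => (cos (d * (lam n - k)))%:C * a n) t =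
   2^-1%:C * (cis (- (d * k)) * ev N a (t - d) + cis (d * k) * ev N a (t + d)).
  rewrite /ev !mulr_sumr -big_split/= mulr_sumr; apply: eq_bigr => i _.
  set l := lam i.
  have -> : (cos (d * (l - k)))%:C = 2^-1%:C * (cis (d * (l - k)) + cis (- (d * (l - k)))).
    by apply/eqP; rewrite eq_complex /= cosN sinN; apply/andP; split; apply/eqP; field.
  have -> : d * (l - k) = - (d * k) + l * d by ring.
  have -> : - (l * (t - d)) = - (l * t) + l * d by ring.
  have -> : - (l * (t + d)) = - (l * t) + - (l * d) by ring.
  by rewrite opprD opprK !cisD; ring.
pose g s := fun t => nc (ev N a (t + s)) `^ p.
have cg s : continuous (g s).
  apply: (@continuous_shift _ (fun t => nc (ev N a t) `^ p)); exact: continuous_ev.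
have mg s : has_mean (g s) (x `^ p).
  apply: (has_mean_shift (f := fun t => nc (ev N a t) `^ p)) => //.
  exact: almost_periodic_ev.
have cZ (f : R -> R) : continuous f -> continuous (fun t => 2^-1 * f t).
  by move=> cf t; apply: cvgMr; exact: cf.
have -> : x `^ p = 2^-1 * x `^ p + 2^-1 * x `^ p by field.
have HM := has_meanD (cZ _ (cg (- d))) (cZ _ (cg d))
  (has_meanZ (c := 2^-1) (cg _) (mg _)) (has_meanZ (c := 2^-1) (cg _) (mg _)).
apply: (le_has_mean (g := fun t => 2^-1 * g (- d) t + 2^-1 * g d t) _ _ _ hm HM).
- exact: continuous_ev.
- by move=> t; apply: cvgD; [exact: (cZ _ (cg (- d)))|exact: (cZ _ (cg d))].
move=> t; rewrite E /g.
apply: (@le_trans _ _ ((2^-1 * nc (ev N a (t - d)) + (1 - 2^-1) * nc (ev N a (t + d))) `^ p)).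
  apply: ge0_ler_powR; rewrite ?nnegrE ?normc_ge0 ?(ltW p0)//.
    by rewrite addr_ge0 ?mulr_ge0 ?normc_ge0//; lra.
  rewrite ComplexField.Normc.normcM normc_real ger0_norm ?invr_ge0//.
  have -> : 1 - 2^-1 = 2^-1 :> R by field.
  rewrite -mulrDr ler_wpM2l ?invr_ge0//.
  apply: le_trans (normcD _ _) _.
  by rewrite !ComplexField.Normc.normcM !normc_cis !mul1r.
apply: le_trans (powR_convex _ _ _ p1) _; rewrite ?normc_ge0//; first by lra.
have -> : 1 - 2^-1 = 2^-1 :> R by field.
by [].
Qed.

Lemma cos_multiplierX N a p (k d : R) m : 1 <= p -> supp_lt N a ->
  dnorm lam p (fun n => (cos (d * (lam n - k)) ^+ m)%:C * a n) <= dnorm lam p a.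
Proof.
move=> p1 aN; elim: m => [|m IH].
  by under eq_fun do rewrite expr0 mul1r.
under eq_fun do rewrite exprS rmorphM/= -mulrA.
apply: le_trans IH; apply: (@cos_multiplier N) => // n Nn.
by rewrite aN ?mulr0.
Qed.

Lemma cvg_sum_ord N (F : nat -> nat -> R) (l : nat -> R) :
  (forall i, F i m @[m --> \oo] --> l i) ->
  \sum_(i < N) F i m @[m --> \oo] --> \sum_(i < N) l i.
Proof.
move=> Fl; elim: N => [|N IH].
  by under eq_fun do rewrite big_ord0; rewrite big_ord0; exact: cvg_cst.
under eq_fun do rewrite big_ord_recr/=.
by rewrite big_ord_recr/=; exact: cvgD.
Qed.

Lemma dist_exp_le (x y : R) n : `|x| <= 1 -> `|y| <= 1 ->
  `|x ^+ n - y ^+ n| <= n%:R * `|x - y|.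
Proof.
move=> x1 y1; elim: n => [|n IH]; first by rewrite !expr0 subrr normr0 mul0r.
have -> : x ^+ n.+1 - y ^+ n.+1 = x * (x ^+ n - y ^+ n) + (x - y) * y ^+ n.
  by rewrite !exprS; ring.
apply: le_trans (ler_normD _ _) _; rewrite !normrM normrX -natr1 mulrDl mul1r.
apply: lerD.
  by apply: le_trans IH; apply: ler_piMl.
by apply: ler_piMr => //; exact: exprn_ile1.
Qed.

(** With [y = x / sqrt (n+1)], both sides are (n+1)-st powers of numbers in the unit ball, so their
    distance is at most [n + 1] times [|cos y - exp(- y^2 / 2)|]. This last distance is [o(y^2)],
    and [(n + 1) * y^2 = x^2]. *)
Lemma cvg_cos_gauss (x : R) :
  cos (x / Num.sqrt n.+1%:R) ^+ n.+1 @[n --> \oo] --> expR (- (x ^+ 2 / 2)).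
Proof.
(* Continuous difference quotients of sine and exponential at 0, both equal to 1 there. They give
   [cos y = 1 - 2 * (g(y/2) * y/2)^2] and [exp v = 1 + h(v) * v] exactly, so no Taylor remainder
   appears. *)
have [g [gE cg g0]] := (is_derive1_caratheodory (@sin R) 0 (cos 0)).1 (is_derive_sin 0).
have [h [hE ch h0]] := (is_derive1_caratheodory (@expR R) 0 (expR 0)).1 (is_derive_expR 0).
rewrite cos0 in g0; rewrite expR0 in h0.
pose y (n : nat) : R := x / Num.sqrt n.+1%:R.
have y2 n : y n ^+ 2 = x ^+ 2 * n.+1%:R^-1.
  by rewrite /y expr_div_n sqr_sqrtr.
have y0 : y n @[n --> \oo] --> 0.
  apply/cvgr0Pnorm_le => e e0.
  have H : x ^+ 2 * harmonic n @[n --> \oo] --> x ^+ 2 * 0 by apply: cvgMr; exact: cvg_harmonic.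
  rewrite mulr0 in H; move/cvgr0Pnorm_le : H => /(_ (e ^+ 2)) H.
  near=> n; rewrite -(@ler_pXn2r _ 2)// ?nnegrE ?(ltW e0)// real_normK ?num_real// y2.
  apply: le_trans (ler_norm _) _; near: n; apply: H; exact: exprn_gt0.
have u0 : y n / 2 @[n --> \oo] --> 0.
  suff H : y n / 2 @[n --> \oo] --> 0 / (2 : R) by rewrite mul0r in H.
  exact: cvgMl.
have v0 : - (y n ^+ 2 / 2) @[n --> \oo] --> (0 : R).
  have : - (y n * (y n / 2)) @[n --> \oo] --> - (0 * 0 : R) by apply: cvgN; exact: cvgM.
  by rewrite mul0r oppr0; under eq_fun do rewrite mulrA -expr2.
have gu : g (y n / 2) @[n --> \oo] --> (1 : R).
  have H : g (y n / 2) @[n --> \oo] --> g 0 by exact: (cvg_comp _ _ u0 cg).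
  by rewrite g0 in H.
have hv : h (- (y n ^+ 2 / 2)) @[n --> \oo] --> (1 : R).
  have H : h (- (y n ^+ 2 / 2)) @[n --> \oo] --> h 0 by exact: (cvg_comp _ _ v0 ch).
  by rewrite h0 in H.
have D : x ^+ 2 / 2 * `|h (- (y n ^+ 2 / 2)) - g (y n / 2) * g (y n / 2)| @[n --> \oo] --> (0 : R).
  suff : x ^+ 2 / 2 * `|h (- (y n ^+ 2 / 2)) - g (y n / 2) * g (y n / 2)| @[n --> \oo] -->
     x ^+ 2 / 2 * `|1 - 1 * 1| by rewrite mulr1 subrr normr0 mulr0.
  by apply: cvgMr; apply: cvg_norm; apply: cvgB => //; exact: cvgM.
apply/cvgrPdist_le => e e0.
move/cvgr0Pnorm_le : D => /(_ _ e0) D.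
near=> n.
have Dn : `|x ^+ 2 / 2 * `|h (- (y n ^+ 2 / 2)) - g (y n / 2) * g (y n / 2)| | <= e.
  by near: n.
have -> : expR (- (x ^+ 2 / 2)) = expR (- (y n ^+ 2 / 2)) ^+ n.+1.
  rewrite -expRM_natr y2; congr expR; have := @pnatr_eq0 R n.+1.
  by move: (n.+1%:R : R) => z z0; field; rewrite z0.
apply: le_trans (dist_exp_le _ _ _) _.
- by rewrite ger0_norm ?expR_ge0// expR_le1 oppr_le0 divr_ge0 ?sqr_ge0.
- exact: cos_max.
have Ec : cos (y n) = 1 - 2 * (g (y n / 2) * (y n / 2)) ^+ 2.
  have := gE (y n / 2); rewrite sin0 !subr0 => <-.
  have {1}-> : y n = (y n / 2) *+ 2 by rewrite -mulr_natr divfK.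
  by rewrite cos_mulr2n cos2sin2; ring.
have Ee : expR (- (y n ^+ 2 / 2)) = 1 + h (- (y n ^+ 2 / 2)) * (- (y n ^+ 2 / 2)).
  have := hE (- (y n ^+ 2 / 2)); rewrite expR0 subr0 => <-.
  by rewrite addrC subrK.
rewrite -/(y n) Ec Ee.
move: Dn; set G := g _; set H := h _ => Dn.
have -> : 1 + H * - (y n ^+ 2 / 2) - (1 - 2 * (G * (y n / 2)) ^+ 2) =
   - (y n ^+ 2 / 2 * (H - G * G)) by field.
rewrite normrN normrM (ger0_norm (divr_ge0 (sqr_ge0 _) _))// y2.
have -> : n.+1%:R * (x ^+ 2 / n.+1%:R / 2 * `|H - G * G|) = x ^+ 2 / 2 * `|H - G * G|.
  have := @pnatr_eq0 R n.+1; move: (n.+1%:R : R) `|H - G * G| => z z' z0.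
  by field; rewrite z0.
exact: le_trans (ler_norm _) Dn.
Unshelve. all: by end_near. Qed.

(** On finitely many coefficients the cosine powers converge to the Gaussian in absolute sum, which
    dominates the norm. *)
Lemma gauss_multiplier N a p (k : R) : 1 <= p -> supp_lt N a ->
  dnorm lam p (fun n => (expR (- ((lam n - k) ^+ 2 / 2)))%:C * a n) <= dnorm lam p a.
Proof.
move=> p1 aN.
apply: le_addgt0 => e e0.
pose c (m n : nat) : R := cos ((Num.sqrt m.+1%:R)^-1 * (lam n - k)) ^+ m.+1.
pose gs (n : nat) : R := expR (- ((lam n - k) ^+ 2 / 2)).
have cv : \sum_(i < N) `|gs i - c m i| * nc (a i) @[m --> \oo] --> (0 : R).
  have H : \sum_(i < N) `|gs i - c m i| * nc (a i) @[m --> \oo] --> \sum_(i < N) `|gs i - gs i|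
    * nc (a i).
    apply: (@cvg_sum_ord N (fun i m => `|gs i - c m i| * nc (a i)) (fun i => `|gs i - gs i| *
      nc (a i))) => i.
    apply: cvgMl; apply: cvg_norm; apply: cvgB; first exact: cvg_cst.
    have := @cvg_cos_gauss (lam i - k).
    by under eq_fun do rewrite mulrC.
  rewrite [X in _ --> X]big1 in H => // i _; by rewrite subrr normr0 mul0r.
move/cvgr0Pnorm_le : cv => /(_ _ e0) cv.
near \oo => m.
have h : \sum_(i < N) `|gs i - c m i| * nc (a i) <= e.
  by apply: le_trans (ler_norm _) _; near: m.
have -> : (fun n => (expR (- ((lam n - k) ^+ 2 / 2)))%:C * a n) =
   (fun n => (c m n)%:C * a n + (gs n - c m n)%:C * a n).
  by apply/funext => n; rewrite -mulrDl -rmorphD/= subrKC.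
have s1 : supp_lt N (fun n => (c m n)%:C * a n) by move=> n Nn; rewrite aN ?mulr0.
have s2 : supp_lt N (fun n => (gs n - c m n)%:C * a n) by move=> n Nn; rewrite aN ?mulr0.
apply: (le_trans (@dnormD _ lam N _ _ p p1 s1 s2)); apply: lerD; first exact: (@cos_multiplierX N).
apply: (le_trans (@dnorm_le_l1 _ lam N _ p p1 s2)); apply: le_trans h; apply: ler_sum => i _.
by rewrite ComplexField.Normc.normcM normc_real.
Unshelve. all: by end_near. Qed.

End GaussianMultiplier.

(** * Signs for which the norm grows like the square root of the length *)

Section RandomSigns.
Context {R : realType} (lam : nat -> R).
Local Open Scope complex_scope.
Local Notation nc := (@ComplexField.Normc.normc R).
Local Notation ev := (ev lam).
Implicit Types (a b : nat -> R[i]) (N : nat) (p q s : R).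

(** Twice [cosh (s * Re z)] plus twice [cosh (s * Im z)]. It dominates [|z|^p] for every [p], and
    its exponentials factor when a term is added to [z], so that signs can be chosen one at a
    time. *)
Definition exp_potential s (z : R[i]) : R :=
  expR (s * complex.Re z) + expR (- s * complex.Re z) +
  (expR (s * complex.Im z) + expR (- s * complex.Im z)).

Lemma exp_potential_ev N a s :
  continuous (fun t => exp_potential s (ev N a t)) /\
  exists m, has_mean (fun t => exp_potential s (ev N a t)) m.
Proof.
have H (x : R -> R) r : trigpoly x -> continuous (fun t => expR (r * x t)) /\
    exists m, has_mean (fun t => expR (r * x t)) m.
  move=> tx; have ap : almost_periodic (fun t => expR (r * x t)).
    apply: (almost_periodic_comp (phi := fun y => expR (r * y))) => //.
    move=> y; apply: (@continuous_comp _ _ _ (fun y => r * y) expR); last exact: continuous_expR.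
    exact: cvgMr.
  by split; [exact: ap.1|exact: almost_periodic_mean].
have tR := trigpoly_Re_ev lam N a; have tI := trigpoly_Im_ev lam N a.
have [c1 [m1 h1]] := H _ s tR; have [c2 [m2 h2]] := H _ (- s) tR.
have [c3 [m3 h3]] := H _ s tI; have [c4 [m4 h4]] := H _ (- s) tI.
have c12 : continuous (fun t => expR (s * complex.Re (ev N a t)) + expR (- s * complex.Re (ev N
  a t))).
  by move=> t; apply: cvgD; [exact: c1|exact: c2].
have c34 : continuous (fun t => expR (s * complex.Im (ev N a t)) + expR (- s * complex.Im (ev N
  a t))).
  by move=> t; apply: cvgD; [exact: c3|exact: c4].
split; first by move=> t; apply: cvgD; [exact: c12|exact: c34].
exists (m1 + m2 + (m3 + m4)).
exact: has_meanD c12 c34 (has_meanD c1 c2 h1 h2) (has_meanD c3 c4 h3 h4).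
Qed.

Lemma exp_potential_split s (z u : R[i]) : 0 <= s <= 2^-1 -> nc u <= 1 ->
  exp_potential s (z + u) + exp_potential s (z - u) <=
  2 * expR (2 * s ^+ 2) * exp_potential s z.
Proof.
move=> /andP[s0 s1] u1.
have H (r x y : R) : `|r| = s -> `|y| <= 1 ->
    expR (r * (x + y)) + expR (r * (x - y)) <= 2 * expR (2 * s ^+ 2) * expR (r * x).
  move=> rs y1; rewrite mulrDr mulrBr !expRD -mulrDr.
  rewrite mulrC; apply: ler_wpM2r; first exact: expR_ge0.
  have h : (expR (r * y) + expR (- (r * y))) / 2 <= expR (2 * (r * y) ^+ 2).
    by apply: cosh_le; rewrite normrM rs; apply: le_trans s1; exact: ler_piMr.
  have h' : expR (2 * (r * y) ^+ 2) <= expR (2 * s ^+ 2).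
    rewrite ler_expR ler_pM2l// exprMn -(real_normK (num_real r)) rs.
    apply: ler_piMr; first exact: sqr_ge0.
    by rewrite -(real_normK (num_real y)); exact: exprn_ile1.
  lra.
have R1 := le_trans (Re_le_normc u) u1; have I1 := le_trans (Im_le_normc u) u1.
have ns : `|- s| = s by rewrite normrN ger0_norm.
have ps : `|s| = s by rewrite ger0_norm.
have h1 := H s (complex.Re z) _ ps R1; have h2 := H (- s) (complex.Re z) _ ns R1.
have h3 := H s (complex.Im z) _ ps I1; have h4 := H (- s) (complex.Im z) _ ns I1.
rewrite /exp_potential; case: z u h1 h2 h3 h4 {R1 I1 u1} => [x y] [v w] /= h1 h2 h3 h4.
lra.
Qed.

(** Apply [x^p <= p^p * exp x] to [x = s * |z| / 2]. The half compensates
    [|z| <= 2 * max(|Re z|, |Im z|)], after which one of the four exponentials suffices. *)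
Lemma normc_powR_le_potential s p (z : R[i]) : 0 < s -> 1 <= p ->
  nc z `^ p <= (2 * p / s) `^ p * exp_potential s z.
Proof.
move=> s0 p1; have p0 : 0 < p by lra.
have z0 := normc_ge0 z.
have -> : nc z `^ p = (2 / s) `^ p * (s / 2 * nc z) `^ p.
  rewrite -powRM ?mulr_ge0 ?invr_ge0 ?(ltW s0)//.
  by congr (_ `^ _); field; rewrite gt_eqF.
have -> : 2 * p / s = 2 / s * p by field; rewrite gt_eqF.
rewrite (powRM (x := 2 / s)) ?divr_ge0 ?(ltW s0) ?(ltW p0)// -[leRHS]mulrA.
apply: ler_wpM2l; first exact: powR_ge0.
apply: (@le_trans _ _ (p `^ p * expR (s / 2 * nc z))).
  by apply: powR_le_expR => //; rewrite mulr_ge0// divr_ge0// ltW.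
apply: ler_wpM2l; first exact: powR_ge0.
have abs (x : R) : expR (s * `|x|) <= expR (s * x) + expR (- s * x).
  have [x0|x0] := leP 0 x.
    by rewrite ger0_norm// lerDl expR_ge0.
  by rewrite ltr0_norm// mulrN mulNr lerDr expR_ge0.
apply: (@le_trans _ _ (expR (s * `|complex.Re z|) + expR (s * `|complex.Im z|))).
  have hz := normc_le_ReIm z.
  have half (x : R) : nc z <= 2 * x -> expR (s / 2 * nc z) <= expR (s * x).
    move=> zx; rewrite ler_expR -mulrA; apply: ler_wpM2l; first exact: ltW.
    by rewrite mulrC ler_pdivrMr// mulrC.
  have [RI|IR] := leP `|complex.Re z| `|complex.Im z|.
    apply: (@le_trans _ _ (expR (s * `|complex.Im z|))); first by apply: half; lra.
    by rewrite lerDr expR_ge0.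
  apply: (@le_trans _ _ (expR (s * `|complex.Re z|))); first by apply: half; lra.
  by rewrite lerDl expR_ge0.
by rewrite lerD.
Qed.

Definition signed_block (b : nat -> bool) (eps : nat -> R) : nat -> R[i] :=
  fun n => (if b n then eps n else 0)%:C.

(* Conditional expectations: of the two signs for the next term, one does not
   raise the mean of the potential above its average. *)
Lemma greedy_signs (b : nat -> bool) s N : 0 <= s <= 2^-1 ->
  exists2 eps : nat -> R, (forall n, eps n = 1 \/ eps n = -1) &
  forall m, has_mean (fun t => exp_potential s (ev N (signed_block b eps) t)) m ->
    m <= 4 * expR (2 * s ^+ 2 * (\sum_(i < N) b i)%:R).
Proof.
move=> s01; elim: N => [|N [eps epsP H]].
  exists (fun=> 1) => [n|m]; first by left.
  under eq_fun do rewrite /ev big_ord0 /exp_potential/= !mulr0 expR0.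
  move=> hm; rewrite (has_mean_unique hm (@has_mean_cst _ _)) big_ord0 mulr0 expR0; lra.
have [_ [m0 hm0]] := exp_potential_ev N (signed_block b eps) s.
have hN := H _ hm0.
have c0 := (exp_potential_ev N (signed_block b eps) s).1.
have evE eps' t : (forall i, (i < N)%N -> eps' i = eps i) ->
    ev N.+1 (signed_block b eps') t = ev N (signed_block b eps) t +
      (if b N then eps' N else 0)%:C * cis (- (lam N * t)).
  move=> E; rewrite /ev big_ord_recr/=; congr (_ + _).
  by apply: eq_bigr => i _; rewrite /signed_block E.
have [bN|bN] := boolP (b N); last first.
  exists eps; [exact: epsP|move=> m].
  have -> : (fun t => exp_potential s (ev N.+1 (signed_block b eps) t)) =
      (fun t => exp_potential s (ev N (signed_block b eps) t)).
    by apply/funext => t; rewrite (evE eps)// (negbTE bN) mul0r addr0.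
  by move=> hm; rewrite (has_mean_unique hm hm0) big_ord_recr/= (negbTE bN) addn0.
pose flip (x : R) n := if n == N then x else eps n.
have flipE x : (forall i, (i < N)%N -> flip x i = eps i).
  by move=> i iN; rewrite /flip ifF//; apply/negbTE; rewrite neq_ltn iN.
have [cp [mp hp]] := exp_potential_ev N.+1 (signed_block b (flip 1)) s.
have [cm [mm hm]] := exp_potential_ev N.+1 (signed_block b (flip (-1))) s.
have avgm : mp + mm <= 0 + 2 * expR (2 * s ^+ 2) * m0.
  apply: (le_has_mean_affine _ c0 _ (has_meanD cp cm hp hm) hm0).
    by move=> t; apply: cvgD; [exact: cp|exact: cm].
  move=> t; rewrite add0r !evE//; try exact: flipE.
  rewrite bN /flip eqxx rmorphN1 mulN1r rmorph1 mul1r.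
  by apply: exp_potential_split; rewrite ?normc_cis.
have fin : 2 * expR (2 * s ^+ 2) * m0 <= 2 * (4 * expR (2 * s ^+ 2 * (\sum_(i < N.+1) b i)%:R)).
  have -> : 2 * s ^+ 2 * (\sum_(i < N.+1) b i)%:R = 2 * s ^+ 2 + 2 * s ^+ 2 * (\sum_(i < N) b i)%:R.
    by rewrite big_ord_recr/= bN natrD mulrDr addrC; congr (_ + _); exact: mulr1.
  rewrite expRD; have := ler_wpM2l (expR_ge0 (2 * s ^+ 2)) hN; lra.
have signs x : x = 1 \/ x = -1 -> forall n, flip x n = 1 \/ flip x n = -1.
  by move=> hx n; rewrite /flip; case: ifP.
have [pm|mp'] := leP mp mm.
  exists (flip 1) => [|m hm']; first by apply: signs; left.
  rewrite (has_mean_unique hm' hp); lra.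
exists (flip (-1)) => [|m hm']; first by apply: signs; right.
rewrite (has_mean_unique hm' hm); lra.
Qed.

(** The constant depends on [p] alone. Its factor [4 * expR 1] bounds the mean of the potential and,
    being at least 1, may be put under the p-th power. *)
Lemma random_signs p : 1 <= p -> exists2 C : R, 0 < C & forall N (b : nat -> bool),
  (forall n, (N <= n)%N -> b n = false) ->
  exists2 eps : nat -> R, (forall n, eps n = 1 \/ eps n = -1) &
  dnorm lam p (signed_block b eps) <= C * Num.sqrt (\sum_(i < N) b i)%:R.
Proof.
move=> p1; have p0 : 0 < p by lra.
exists (4 * p * (4 * expR 1)); first by rewrite !mulr_gt0// expR_gt0.
move=> N b bN; set K := (\sum_(i < N) b i)%N.
have supp eps : supp_lt N (signed_block b eps) by move=> n Nn; rewrite /signed_block bN.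
have [K0|K0] := posnP K.
  exists (fun=> 1) => [n|]; first by left.
  rewrite K0 sqrtr0 mulr0; apply: (le_trans (@dnorm_le_l1 _ lam N _ p p1 _)) => //.
  rewrite big1// => i _; rewrite /signed_block.
  have /eqP : (\sum_(i < N) b i)%N = 0%N by [].
  rewrite sum_nat_eq0 => /forallP/(_ i)/implyP/(_ isT); rewrite eqb0 => /negbTE ->.
  exact: ComplexField.Normc.normc0.
pose r : R := Num.sqrt K%:R.
have r2 : r ^+ 2 = K%:R by rewrite sqr_sqrtr.
have r0 : 0 < r by rewrite sqrtr_gt0 ltr0n.
have r1 : 1 <= r by rewrite -(@ler_pXn2r _ 2)// ?nnegrE ?(ltW r0)// r2 expr1n ler1n.
(* This scale makes [2 * s^2 * K = 1/2], so the potential stays bounded, while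
   [2 * p / s = 4 * p * sqrt K] has the desired order. *)
pose s := (2 * r)^-1.
have s0 : 0 < s by rewrite invr_gt0 mulr_gt0.
have s01 : 0 <= s <= 2^-1.
  by rewrite (ltW s0)/= lef_pV2 ?posrE ?mulr_gt0//; lra.
have [eps epsP H] := greedy_signs b N s01.
exists eps => //.
have [cF [m hm]] := exp_potential_ev N (signed_block b eps) s.
have {}H := H _ hm; rewrite -/K in H.
have sE : 2 * s ^+ 2 * K%:R = 2^-1 by rewrite -r2 /s; field; rewrite gt_eqF.
rewrite sE in H.
have C0 : 0 <= 4 * p * (4 * expR 1) * r.
  by rewrite !mulr_ge0 ?expR_ge0 ?(ltW p0) ?(ltW r0).
apply: (dnorm_le p1 (supp eps) C0) => m' hm'.
have := @le_has_mean_affine _ _ _ _ _ 0 ((2 * p / s) `^ p) (@continuous_ev _ lam N _ p p0) cF _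
  hm' hm.
have F t : nc (ev N (signed_block b eps) t) `^ p <=
   0 + (2 * p / s) `^ p * exp_potential s (ev N (signed_block b eps) t).
  by rewrite add0r; exact: normc_powR_le_potential.
move=> /(_ F) h; apply: (le_trans h); rewrite add0r.
have -> : 4 * p * (4 * expR 1) * r = (2 * p / s) * (4 * expR 1).
  by rewrite /s; field; rewrite gt_eqF.
rewrite (powRM (x := 2 * p / s) (y := 4 * expR 1))
  ?mulr_ge0 ?invr_ge0 ?mulr_ge0 ?expR_ge0 ?(ltW p0) ?(ltW r0)//.
apply: ler_wpM2l; first exact: powR_ge0.
have e1 : 1 <= expR (1 : R) by have := expR_ge1Dx (1 : R); lra.
apply: (@le_trans _ _ (4 * expR 1)); last by apply: le1r_powR => //; lra.
apply: (le_trans H); rewrite ler_pM2l// ler_expR; lra.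
Qed.

End RandomSigns.

#[local] Opaque dnorm.

(** * Hardy spaces and the exponent [S_p] *)

Lemma sum_ord_diff (V : zmodType) (F : nat -> V) j k : (j <= k)%N ->
  \sum_(i < k) F i - \sum_(i < j) F i = \sum_(i < k - j) F (j + i)%N.
Proof. by move=> /subnKC <-; rewrite big_split_ord/= addrAC subrr add0r addKn. Qed.

Section HardySpace.
Context {R : realType} (lam : nat -> R).
Local Open Scope complex_scope.
Local Notation nc := (@ComplexField.Normc.normc R).
Implicit Types (a b : nat -> R[i]) (N : nat) (p q : R).
Hypothesis hlam : frequency lam.

Lemma frequency_inj : injective lam.
Proof. by case: hlam => /inc_inj. Qed.

Lemma frequency_ge0 n : 0 <= lam n.
Proof. by case: hlam. Qed.

Lemma frequency_le m n : (m <= n)%N -> lam m <= lam n.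
Proof. by case: hlam => h _ _ mn; rewrite h. Qed.

Lemma frequency_gt0 n : (0 < n)%N -> 0 < lam n.
Proof.
move=> n0; rewrite lt_neqAle frequency_ge0 andbT eq_sym; apply/eqP => ln0.
have l0 : lam 0%N = 0.
  by apply/eqP; rewrite eq_le frequency_ge0 andbT -ln0 frequency_le.
by rewrite (frequency_inj (etrans ln0 (esym l0))) in n0.
Qed.

Lemma dpolyP a : dpoly a <-> exists N, supp_lt N a.
Proof.
split=> [fa|[N aN]].
  have /finite_seqP[r rE] := fa.
  exists (\max_(i <- r) i).+1 => n Nn.
  apply/eqP; apply: contraTT Nn => an0; rewrite -ltnNge ltnS.
  apply: (@leq_bigmax_seq _ _ xpredT id) => //.
  by have : [set n | a n != 0] n by []; rewrite rE.
apply: (@sub_finite_set _ _ `I_N); last exact: finite_II.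
move=> n /= an0; rewrite ltnNge; apply: contra an0 => Nn.
by rewrite aN.
Qed.

(** Absolute convergence at any point of real part [s]: the terms are non-negative and depend only
    on the real part. *)
Definition abs_bounded a (s : R) : Prop :=
  exists B : R, forall N, \sum_(i < N) nc (a i) * expR (- (lam i * s)) <= B.

Lemma abs_boundedW a s s' : s <= s' -> abs_bounded a s -> abs_bounded a s'.
Proof.
move=> ss' [B HB]; exists B => N; apply: le_trans (HB N).
apply: ler_sum => i _; apply: ler_wpM2l; first exact: normc_ge0.
by rewrite ler_expR lerN2; apply: ler_wpM2l => //; exact: frequency_ge0.
Qed.

Lemma abs_cvg_atP a (s : R[i]) : abs_cvg_at lam a s <-> abs_bounded a (complex.Re s).
Proof.
have E n : nc (dterm lam a s n) = nc (a n) * expR (- (lam n * complex.Re s)).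
  rewrite /dterm /cexp !ComplexField.Normc.normcM normc_real ger0_norm ?expR_ge0//.
  have -> x : nc (cos x +i* sin x) = 1 by exact: (normc_cis x).
  by rewrite mulr1; congr (_ * expR _); case: s => x y /=; ring.
rewrite /abs_cvg_at; under eq_fun do rewrite E.
set u := fun n => _; have u0 n : 0 <= u n by rewrite mulr_ge0 ?normc_ge0 ?expR_ge0.
split=> [cu|[B HB]].
  exists (limn (series u)) => N.
  have := nondecreasing_cvgn_le (nondecreasing_series (fun n _ _ => u0 n)) cu N.
  by rewrite /series/= big_mkord.
apply: nondecreasing_is_cvgn.
  by apply: nondecreasing_series => n _ _; exact: u0.
by exists B => _ [N _ <-]; rewrite /series/= big_mkord.
Qed.

Lemma sigma_a_le a (s : R) : abs_bounded a s -> (sigma_a lam a <= s%:E)%E.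
Proof.
move=> h; apply: ereal_inf_lbound; exists s => //= z sz.
apply/abs_cvg_atP; apply: abs_boundedW h; exact: ltW.
Qed.

Lemma sigma_a_lt a (s : R) : (sigma_a lam a < s%:E)%E -> abs_bounded a s.
Proof.
move=> /ereal_inf_lt[_ [r /= hr <-]]; rewrite lte_fin => rs.
by have /abs_cvg_atP := hr (s%:C) rs.
Qed.

Lemma sigma_a_leP a (v : R) :
  (sigma_a lam a <= v%:E)%E <-> forall e : R, 0 < e -> abs_bounded a (v + e).
Proof.
split=> [h e e0|h].
  by apply/sigma_a_lt/(le_lt_trans h); rewrite lte_fin ltrDl.
by apply/lee_addgt0Pr => e e0; rewrite -EFinD; exact/sigma_a_le/h.
Qed.

Lemma normc_dtranslate a (r : R) n :
  nc (dtranslate lam a r n) = nc (a n) * expR (- (lam n * r)).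
Proof.
rewrite /dtranslate ComplexField.Normc.normcM /cexp /= oppr0 cos0 sin0.
congr (_ * _); rewrite !(mul0r, mulr0, mulr1, subr0, addr0) expr0n/= addr0 sqrtr_sqr.
by rewrite ger0_norm ?expR_ge0.
Qed.

Lemma dtranslate0 a : dtranslate lam a 0 = a.
Proof.
apply/funext => n; rewrite /dtranslate /cexp /= mulr0 !oppr0 cos0 sin0 expR0.
by case: (a n) => x y; apply/eqP; rewrite eq_complex /=; apply/andP; split; apply/eqP; ring.
Qed.

Lemma abs_bounded_translate a (r s : R) :
  abs_bounded (dtranslate lam a r) s <-> abs_bounded a (r + s).
Proof.
suff E N : \sum_(i < N) nc (dtranslate lam a r i) * expR (- (lam i * s)) =
    \sum_(i < N) nc (a i) * expR (- (lam i * (r + s))).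
  by split=> -[B HB]; exists B => N; [rewrite -E|rewrite E].
by apply: eq_bigr => i _; rewrite normc_dtranslate -mulrA -expRD mulrDr opprD.
Qed.

Lemma hardy_zero p : 1 <= p -> hardy lam p (fun=> 0).
Proof.
move=> p1; exists (fun _ _ => 0); split.
- by move=> _; apply/dpolyP; exists 0%N.
- move=> e e0; exists 0%N => j k _ _.
  apply: le_lt_trans e0; under eq_fun do rewrite subrr.
  by apply: (le_trans (@dnorm_le_l1 _ lam 0 _ p p1 _)) => //; rewrite big_ord0.
- by move=> n; under eq_fun do rewrite subrr ComplexField.Normc.normc0; exact: cvg_cst.
Qed.

(** The zero series has both abscissas equal to [-oo], where the convention for equal infinities
    gives 0. *)
Lemma S_p_ge0 p : 1 <= p -> (0 <= S_p lam p)%E.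
Proof.
move=> p1; pose z : nat -> R[i] := fun=> 0.
have NyP (x : \bar R) : (forall s : R, (x <= s%:E)%E) -> x = -oo%E.
  case: x => [r| |] h //.
    by have := h (r - 1); rewrite lee_fin => ?; exfalso; lra.
  by have := h 0.
have sa : sigma_a lam z = -oo%E.
  apply: NyP => s; apply: sigma_a_le; exists 0 => N.
  by rewrite big1// => i _; rewrite ComplexField.Normc.normc0 mul0r.
have sp : sigma_p lam p z = -oo%E.
  apply: NyP => s; apply: ereal_inf_lbound; exists s => //=.
  have -> : dtranslate lam z s = fun=> 0 by apply/funext => n; rewrite /dtranslate mul0r.
  exact: hardy_zero.
apply: ereal_sup_ubound; exists z => //.
by rewrite sa sp /esub0 eqxx.
Qed.

Lemma sigma_a_le_S_p p a : 1 <= p -> hardy lam p a -> (sigma_a lam a <= S_p lam p)%E.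
Proof.
move=> p1 ha.
have sp0 : (sigma_p lam p a <= 0)%E.
  by apply: ereal_inf_lbound; exists 0 => //=; rewrite dtranslate0.
have h : (esub0 (sigma_a lam a) (sigma_p lam p a) <= S_p lam p)%E.
  by apply: ereal_sup_ubound; exists a.
move: h; rewrite /esub0; case: eqP => [-> _|ne h].
  exact: le_trans sp0 (S_p_ge0 p1).
apply: le_trans h; case: (sigma_a lam a) ne => [x| |] ne; last exact: leNye.
- case: (sigma_p lam p a) sp0 => [y| |]//=; last by rewrite leey.
  by rewrite -EFinB !lee_fin; lra.
- by case: (sigma_p lam p a) sp0 => [y| |].
Qed.

(** Translating by an admissible [r] puts a series into the Hardy space, so its [sigma_a] is at most
    [r + v]; then take the infimum over [r]. Together with [sigma_a_le_S_p] this reduces [S_p] to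
    the supremum of [sigma_a] over the Hardy space. *)
Lemma S_p_le p (v : R) : 1 <= p -> 0 <= v ->
  (forall a, hardy lam p a -> (sigma_a lam a <= v%:E)%E) -> (S_p lam p <= v%:E)%E.
Proof.
move=> p1 v0 H; apply: ge_ereal_sup => _ [a _ <-].
rewrite /esub0; case: eqP => [_|ne]; first by rewrite lee_fin.
have K (r : R) : hardy lam p (dtranslate lam a r) -> (sigma_a lam a <= (r + v)%:E)%E.
  move=> /H/sigma_a_leP h; apply/sigma_a_leP => e /h /abs_bounded_translate.
  by rewrite addrA.
have K' : (forall y : \bar R, sigma_p lam p a = y -> y != +oo -> sigma_a lam a <= y + v%:E)%E.
  move=> y <- yp; rewrite -leeBlDr//; apply: le_ereal_inf_tmp => _ [r hr <-].
  by rewrite leeBlDr// -EFinD; exact: K.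
case: (sigma_p lam p a) K' ne => [y| |] K' ne.
- by rewrite leeBlDr// addeC; exact: K'.
- by case: (sigma_a lam a) ne => [x| |] ne //=; rewrite leNye.
- by have := K' _ erefl isT; case: (sigma_a lam a) ne => [x| |] ne //; have := ne erefl.
Qed.

Lemma le_S_p p q : 1 <= p -> p <= q -> (S_p lam q <= S_p lam p)%E.
Proof.
move=> p1 pq; have q1 : 1 <= q by lra.
have sub a : hardy lam q a -> hardy lam p a.
  move=> [P [Pd Pc Pa]]; exists P; split; [exact: Pd| |exact: Pa] => e /Pc[N HN].
  exists N => j k jN kN; apply: le_lt_trans (HN _ _ jN kN).
  have [Nj hj] := (dpolyP _).1 (Pd j); have [Nk hk] := (dpolyP _).1 (Pd k).
  apply: (@le_dnorm _ _ (maxn Nj Nk)) => // n; rewrite geq_max => /andP[jn kn].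
  by rewrite hj// hk// subrr.
have := S_p_ge0 p1; case E : (S_p lam p) => [v| |]// v0; last by rewrite leey.
apply: S_p_le => // a /sub ha.
by rewrite -E; exact: sigma_a_le_S_p.
Qed.

(** The form in which membership enters all upper bounds: approximants of bounded norm with
    convergent coefficients. *)
Lemma hardy_bounded p a : 1 <= p -> hardy lam p a ->
  exists (P : nat -> nat -> R[i]) (M : R),
  [/\ forall k, exists N, supp_lt N (P k), forall k, dnorm lam p (P k) <= M &
      forall n, nc (P k n - a n) @[k --> \oo] --> 0].
Proof.
move=> p1 [P [Pd Pc Pa]].
have [N HN] := Pc 1 ltr01.
exists (fun k => P (N + k)%N), (1 + dnorm lam p (P N)); split.
- by move=> k; apply/dpolyP/Pd.
- move=> k; have [Nj hj] := (dpolyP _).1 (Pd (N + k)%N); have [Nk hk] := (dpolyP _).1 (Pd N).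
  pose S := maxn Nj Nk.
  have s1 : supp_lt S (fun n => P (N + k)%N n - P N n).
    by move=> n; rewrite geq_max => /andP[jn kn]; rewrite hj// hk// subrr.
  have s2 : supp_lt S (P N) by move=> n; rewrite geq_max => /andP[jn kn]; rewrite hk.
  have -> : P (N + k)%N = (fun n => (P (N + k)%N n - P N n) + P N n).
    by apply/funext => n; rewrite subrK.
  apply: (le_trans (@dnormD _ lam S _ _ p p1 s1 s2)).
  by rewrite lerD2r ltW// HN// leq_addr.
- move=> n; have := Pa n; rewrite -(cvg_shiftn N).
  by under eq_fun do rewrite addnC.
Qed.

Lemma real_cauchy_cvg (u : nat -> R) :
  (forall e : R, 0 < e -> exists N, forall j k, (N <= j)%N -> (N <= k)%N -> `|u j - u k| < e) ->
  exists l : R, u n @[n --> \oo] --> l.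
Proof.
move=> H; suff : cvg (u n @[n --> \oo]) by move=> ?; exists (lim (u n @[n --> \oo])).
apply/cauchy_cvgP/cauchy_exP => e /H[N HN]; exists (u N).
by exists N => //= k Nk; rewrite /ball/= HN.
Qed.

(** The source of all constructed elements: an absolutely convergent series of polynomials has
    Cauchy partial sums, and since the norm bounds each coefficient, the coefficients converge
    too. *)
Lemma hardy_sum p (Q : nat -> nat -> R[i]) (c : nat -> R) (B : R) : 1 <= p ->
  (forall k, exists N, supp_lt N (Q k)) ->
  (forall k, dnorm lam p (Q k) <= c k) ->
  (forall K, \sum_(k < K) c k <= B) ->
  exists2 a, hardy lam p a &
    forall n, nc (\sum_(k < K) Q k n - a n) @[K --> \oo] --> 0.
Proof.
move=> p1 Qs Qc cB; have p0 : 0 < p by lra.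
have c0 k : 0 <= c k.
  by have [N QN] := Qs k; apply: le_trans (Qc k); exact: (@dnorm_ge0 _ lam N).
pose S K := \sum_(k < K) c k.
have Scauchy (e : R) : 0 < e -> exists N, forall j k, (N <= j)%N -> (j <= k)%N -> S k - S j < e.
  move=> e0.
  have : cvgn (series c).
    apply: nondecreasing_is_cvgn; first by apply: nondecreasing_series => n _ _; exact: c0.
    by exists B => _ [N _ <-]; rewrite /series/= big_mkord.
  move=> /cauchy_cvgP /cauchy_seriesP/(_ _ e0)[[/= A1 A2] [[N1 _ hN1] [N2 _ hN2]] hA].
  exists (maxn N1 N2) => j k; rewrite geq_max => /andP[j1 j2] jk.
  have h : `|\sum_(j <= i < k) c i| < e.
    by apply: (hA (j, k)); split; [exact: hN1|apply: hN2; exact: leq_trans jk].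
  apply: le_lt_trans h; suff -> : S k - S j = \sum_(j <= i < k) c i by exact: ler_norm.
  rewrite /S sum_ord_diff// -[X in _ = \sum_(X <= i < k) _](add0n j) big_addn big_mkord.
  by apply: eq_bigr => i _; rewrite addnC.
pose P K n := \sum_(k < K) Q k n.
have PS K : exists N, supp_lt N (P K) /\ forall k, (k < K)%N -> supp_lt N (Q k).
  elim: K => [|K [N [_ hN]]]; first by exists 0%N; split=> // n _; rewrite /P big_ord0.
  have [N' hN'] := Qs K; exists (maxn N N').
  have h k : (k < K.+1)%N -> supp_lt (maxn N N') (Q k).
    rewrite ltnS leq_eqVlt => /orP[/eqP ->|kK]; first by apply: supp_ltW hN'; exact: leq_maxr.
    by apply: supp_ltW (hN _ kK); exact: leq_maxl.
  by split=> // n Nn; rewrite /P big1// => i _; exact: (h i).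
have diff j k : (j <= k)%N -> dnorm lam p (fun n => P k n - P j n) <= S k - S j.
  move=> jk; have [N [_ hN]] := PS k.
  have -> : (fun n => P k n - P j n) = (fun n => \sum_(i < k - j) Q (j + i)%N n).
    by apply/funext => n; rewrite /P (sum_ord_diff (fun i => Q i n)).
  have -> : S k - S j = \sum_(i < k - j) c (j + i)%N.
    by rewrite /S sum_ord_diff.
  (* [dnorm_sum] asks for one support bound valid for every index, so the terms outside the range
     are replaced by zero. *)
  have hN' i : supp_lt N (if (i < k - j)%N then Q (j + i)%N else fun=> 0).
    by case: ifP => // ik; apply: hN; rewrite -ltn_subRL.
  have -> : (fun n => \sum_(i < k - j) Q (j + i)%N n) =
      (fun n => \sum_(i < k - j) (if (i < k - j)%N then Q (j + i)%N else fun=> 0) n).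
    by apply/funext => n; apply: eq_bigr => i _; rewrite ltn_ord.
  apply: (le_trans (@dnorm_sum _ lam N _ p (k - j) p1 hN')).
  by apply: ler_sum => i _; rewrite ltn_ord.
have flipB j k : dnorm lam p (fun n => P j n - P k n) <= dnorm lam p (fun n => P k n - P j n).
  have [N [hj _]] := PS j; have [N' [hk _]] := PS k.
  have s : supp_lt (maxn N N') (fun n => P k n - P j n).
    by move=> n; rewrite geq_max => /andP[n1 n2]; rewrite hj// hk// subrr.
  have -> : (fun n => P j n - P k n) = (fun n => -1 * (P k n - P j n)).
    by apply/funext => n; rewrite mulN1r opprB.
  apply: (le_trans (@dnormZ _ lam (maxn N N') _ p (-1) p1 s)).
  by rewrite normcN ComplexField.Normc.normc1 mul1r.
have Pcauchy (e : R) : 0 < e -> exists N, forall j k, (N <= j)%N -> (N <= k)%N ->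
    dnorm lam p (fun n => P j n - P k n) < e.
  move=> /Scauchy[N HN]; exists N => j k Nj Nk.
  have [jk|kj] := leqP j k.
    by apply: (le_lt_trans (flipB j k)); apply: le_lt_trans (diff _ _ jk) _; exact: HN.
  by apply: le_lt_trans (diff _ _ (ltnW kj)) _; apply: HN => //; exact: ltnW.
have coef n j k : nc (P j n - P k n) <= dnorm lam p (fun n => P j n - P k n).
  have [N [hj _]] := PS j; have [N' [hk _]] := PS k.
  apply: (@coef_le_dnorm _ lam frequency_inj (maxn N N') (fun n => P j n - P k n)) => //.
  by move=> m; rewrite geq_max => /andP[n1 n2]; rewrite hj// hk// subrr.
have lims n : exists z : R[i], nc (P K n - z) @[K --> \oo] --> 0.
  have [x hx] : exists x : R, complex.Re (P K n) @[K --> \oo] --> x.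
    apply: real_cauchy_cvg => e /Pcauchy[N HN]; exists N => j k Nj Nk.
    apply: le_lt_trans (HN _ _ Nj Nk); apply: le_trans (coef n j k).
    by apply: le_trans (Re_le_normc _); rewrite raddfB.
  have [y hy] : exists y : R, complex.Im (P K n) @[K --> \oo] --> y.
    apply: real_cauchy_cvg => e /Pcauchy[N HN]; exists N => j k Nj Nk.
    apply: le_lt_trans (HN _ _ Nj Nk); apply: le_trans (coef n j k).
    by apply: le_trans (Im_le_normc _); rewrite raddfB.
  exists (x +i* y).
  apply: (@squeeze_cvgr _ _ _ _ (fun=> 0)
    (fun K => `|complex.Re (P K n) - x| + `|complex.Im (P K n) - y|)).
  - near=> K; rewrite normc_ge0/=; apply: le_trans (normc_le_ReIm _) _.
    by rewrite !raddfB.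
  - exact: cvg_cst.
  - have -> : 0 = `|x - x| + `|y - y| :> R by rewrite !subrr normr0 addr0.
    by apply: cvgD; apply: cvg_norm; apply: cvgB => //; exact: cvg_cst.
pose a n := projT1 (cid (lims n)).
have aP n : nc (P K n - a n) @[K --> \oo] --> 0 by exact: (projT2 (cid (lims n))).
exists a => //; exists P; split => //.
by move=> K; apply/dpolyP; have [N [h _]] := PS K; exists N.
Unshelve. all: by end_near. Qed.

End HardySpace.

(** * Geometric series and the zeta series *)

Section ElementarySeries.
Context {R : realType}.

Lemma geometric_bounded (x : R) K : 0 <= x -> x < 1 -> \sum_(k < K) x ^+ k <= (1 - x)^-1.
Proof.
move=> x0 x1; have x1' : 0 < 1 - x by lra.
rewrite -[leRHS]mul1r ler_pdivlMr// mulrC.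
have -> : (1 - x) * \sum_(k < K) x ^+ k = 1 - x ^+ K.
  elim: K => [|K IH]; first by rewrite big_ord0 mulr0 expr0 subrr.
  by rewrite big_ord_recr/= mulrDr IH exprS; ring.
by rewrite gerBl exprn_ge0.
Qed.

(** The integral test as a telescoping bound: with [r = s - 1], [y^(-s)] is at most
    [((y - 1)^(-r) - y^(-r)) / r], because [ln (y - 1) <= ln y - 1 / y]. *)
Lemma zeta_bounded (s : R) : 1 < s ->
  exists B : R, forall N, \sum_(i < N) expR (- (s * ln i.+1%:R)) <= B.
Proof.
move=> s1; pose r := s - 1; have r0 : 0 < r by rewrite /r; lra.
have main M : \sum_(i < M.+1) expR (- (s * ln i.+1%:R)) <=
    1 + r^-1 * (1 - expR (- (r * ln M.+1%:R))).
  elim: M => [|M IH].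
    by rewrite big_ord1 ln1 !mulr0 oppr0 expR0 subrr mulr0 addr0.
  rewrite big_ord_recr/=.
  have y0 : 0 < M.+2%:R :> R by rewrite ltr0n.
  have y1 : (M.+1%:R : R) = M.+2%:R - 1 by rewrite -(natr1 M.+1) addrK.
  have y10 : 0 < (M.+2%:R : R) - 1 by rewrite -y1 ltr0n.
  rewrite y1 in IH; move: (M.+2%:R : R) y0 y10 IH {y1} => y y0 y10 IH.
  have lnB : ln (y - 1) <= ln y - y^-1.
    have lnle (z : R) : 0 < z -> ln z <= z - 1.
      by move=> z0; have := expR_ge1Dx (ln z); rewrite lnK ?posrE//; lra.
    have := lnle _ (divr_gt0 y10 y0).
    rewrite ln_div ?posrE// => h.
    have e : (y - 1) / y - 1 = - y^-1 by field; rewrite gt_eqF.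
    by rewrite e in h; lra.
  have h1 : expR (- (r * ln y)) * (1 + r / y) <= expR (- (r * ln (y - 1))).
    apply: (@le_trans _ _ (expR (- (r * ln y)) * expR (r / y))).
      by apply: ler_wpM2l; [exact: expR_ge0|exact: expR_ge1Dx].
    rewrite -expRD ler_expR.
    have := ler_wpM2l (ltW r0) lnB; rewrite mulrBr; lra.
  have h2 : expR (- (s * ln y)) = expR (- (r * ln y)) / y.
    have -> : - (s * ln y) = - (r * ln y) - ln y by rewrite /r; ring.
    by rewrite expRB lnK ?posrE.
  rewrite h2.
  have h3 : expR (- (r * ln y)) / y <=
      r^-1 * (expR (- (r * ln (y - 1))) - expR (- (r * ln y))).
    rewrite mulrC ler_pdivlMl//.
    have e : r * (y^-1 * expR (- (r * ln y))) = expR (- (r * ln y)) * (1 + r / y) - expR (- (r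
      * ln y)).
      by field; rewrite gt_eqF.
    by rewrite e; lra.
  lra.
exists (1 + r^-1) => N.
apply: (@le_trans _ _ (\sum_(i < N.+1) expR (- (s * ln i.+1%:R)))).
  by rewrite big_ord_recr/= lerDl expR_ge0.
apply: (le_trans (main N)); rewrite lerD2l -[leRHS]mulr1.
apply: ler_wpM2l; first by rewrite invr_ge0 ltW.
by rewrite gerBl expR_ge0.
Qed.

End ElementarySeries.

(** * The exponent [L]: the lower bound for every [p], the upper bound at 2 *)

Section ExponentOfConvergence.
Context {R : realType} (lam : nat -> R).
Local Open Scope complex_scope.
Local Notation nc := (@ComplexField.Normc.normc R).
Implicit Types (a b : nat -> R[i]) (N : nat) (p q : R).
Hypothesis hlam : frequency lam.

(** The condition [0 < n] excludes the quotient by [lam 0], which may be a division by zero. *)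
Lemma freqL_gt (l : R) : (l%:E < freqL lam)%E ->
  forall n0, exists n, [/\ (n0 <= n)%N, (0 < n)%N & l * lam n < ln n.+1%:R].
Proof.
move=> hl n0; pose n1 := maxn n0 1.
have : (l%:E < ereal_sup ((fun n => (ln n.+1%:R / lam n)%:E) @` [set k | (n1 <= k)%N]))%E.
  apply: (lt_le_trans hl); apply: ereal_inf_lbound.
  by exists [set k | (n1 <= k)%N] => //; exists n1.
move=> /ereal_sup_gt[_ [n /= n1n <-]]; rewrite lte_fin => h.
move: n1n; rewrite geq_max => /andP[n0n n1n].
exists n; split => //; rewrite ltr_pdivlMr// in h.
exact: frequency_gt0.
Qed.

Lemma freqL_lt (l : R) : (freqL lam < l%:E)%E ->
  exists n0, forall n, (n0 <= n)%N -> (0 < n)%N -> ln n.+1%:R <= l * lam n.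
Proof.
move=> /ereal_inf_lt[_ [A [n0 _ hA] <-]] hs.
exists n0 => n n0n n_gt0.
have : ((ln n.+1%:R / lam n)%:E <= l%:E)%E.
  apply: le_trans (ltW hs); apply: ereal_sup_ubound; exists n => //.
  exact: hA.
by rewrite lee_fin ler_pdivrMr//; exact: frequency_gt0.
Qed.

Lemma freqL_ge0 : (0 <= freqL lam)%E.
Proof.
rewrite leNgt; apply/negP => L0.
have /ereal_inf_lt[_ [A [n0 _ hA] <-]] := L0.
apply/negP; rewrite -leNgt.
apply: (@le_trans _ _ ((ln n0.+1%:R / lam n0)%:E)).
  by rewrite lee_fin divr_ge0 ?(frequency_ge0 hlam)// ln_ge0// ler1n.
by apply: ereal_sup_ubound; exists n0 => //; apply: hA => /=.
Qed.

(** Eventually [n + 1 <= exp(l * lam n)], so the terms are dominated by [(n + 1)^(- tau / l)] with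
    [tau / l > 1]. *)
Lemma sum_exp_frequency (l tau : R) : (freqL lam < l%:E)%E -> 0 < l -> l < tau ->
  exists B : R, forall N, \sum_(i < N) expR (- (lam i * tau)) <= B.
Proof.
move=> hl l0 ltau; have [n0 Hn0] := freqL_lt hl.
pose s := tau / l.
have s1 : 1 < s by rewrite /s ltr_pdivlMr// mul1r.
have s0 : 0 < s by lra.
have [B HB] := zeta_bounded s1.
(* This factor pays for the indices up to [n0], where only [exp(- lam i * tau) <= 1] is
   available. *)
pose K : R := expR (s * ln n0.+1%:R).
exists (K * B) => N.
apply: (@le_trans _ _ (\sum_(i < N) K * expR (- (s * ln i.+1%:R)))); last first.
  by rewrite -mulr_sumr; apply: ler_wpM2l => //; exact: expR_ge0.
apply: ler_sum => i _; rewrite /K -expRD ler_expR.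
have [ni|ni] := leqP n0.+1 i.
  have i0 : (0 < i)%N by exact: leq_trans ni.
  have h := Hn0 _ (ltnW ni) i0.
  have : s * ln (i.+1%:R : R) <= lam i * tau.
    have -> : lam i * tau = s * (l * lam i) by rewrite /s; field; rewrite gt_eqF.
    by apply: ler_wpM2l => //; exact: ltW.
  have : 0 <= s * ln (n0.+1%:R : R) by rewrite mulr_ge0 ?(ltW s0)// ln_ge0// ler1n.
  lra.
have : 0 <= lam i * tau by rewrite mulr_ge0 ?(frequency_ge0 hlam)//; lra.
have : s * ln (i.+1%:R : R) <= s * ln (n0.+1%:R : R).
  by apply: ler_wpM2l; [exact: ltW|rewrite ler_ln ?posrE ?ltr0n// ler_nat].
lra.
Qed.

(** If [2 * v < L], signed dyadic blocks give a series with [|a_n| >= (n + 1)^(- 1/2 - eta)] whose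
    block norms decay like [2^(- eta * j)], so it lies in the Hardy space. At an abscissa [sg > v]
    its partial sums reach [(n + 1)^eta] whenever [l * lam n < ln (n + 1)], hence infinitely
    often. *)
Lemma freqL_le_S_p p (v : R) : 1 <= p -> 0 <= v -> (S_p lam p <= v%:E)%E ->
  (freqL lam <= (2 * v)%:E)%E.
Proof.
move=> p1 v0 Sv; rewrite leNgt; apply/negP => vL.
have [l vl lL] : exists2 l : R, 2 * v < l & (l%:E < freqL lam)%E.
  move: vL freqL_ge0; case: (freqL lam) => [L| |]//.
    rewrite lte_fin => vL _; exists (v + L / 2); rewrite ?lte_fin; lra.
  by move=> _ _; exists (2 * v + 1); rewrite ?ltry//; lra.
have l0 : 0 < l by lra.
(* [sg] lies halfway between [v] and [l / 2], and [eta] is half the gap left between [sg / l] and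
   [1/2]; this gives [1 - r - sg / l = eta]. *)
pose sg := (v + l / 2) / 2.
have vsg : v < sg by rewrite /sg; lra.
have sgl : sg / l < 2^-1 by rewrite ltr_pdivrMr// /sg; lra.
pose eta := (2^-1 - sg / l) / 2.
have eta0 : 0 < eta by rewrite /eta; lra.
pose r := 2^-1 + eta.
have [C C0 HC] := random_signs lam p1.
(* Block [j] consists of the [n] with [2^j <= n + 1 < 2^(j+1)]; the shift places index 0 in block
   0. *)
pose bl j n := trunc_log 2 n.+1 == j.
have bl0 j n : (2 ^ j.+1 <= n)%N -> bl j n = false.
  move=> jn; apply/negbTE/eqP => tj.
  have := @trunc_log_ltn 2 n.+1 isT; rewrite tj => h.
  by have := leq_trans (ltnW h) jn; rewrite ltnn.
have /choice[eps Heps] : forall j, exists eps : nat -> R, (forall n, eps n = 1 \/ eps n = -1) /\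
    dnorm lam p (signed_block (bl j) eps) <= C * Num.sqrt (2 ^ j.+1)%:R.
  move=> j; have [eps h1 h2] := HC _ _ (bl0 j); exists eps; split; first exact: h1.
  apply: (le_trans h2); apply: ler_wpM2l; first exact: ltW.
  rewrite ler_sqrt ?ler0n// ler_nat.
  apply: (@leq_trans (\sum_(i < 2 ^ j.+1) 1)); last by rewrite sum1_card card_ord.
  by apply: leq_sum => i _; case: (bl j i).
pose x0 : R := expR (- (r * ln 2)).
pose y0 : R := x0 * Num.sqrt 2.
have ln2 : 0 < ln 2 :> R by rewrite ln_gt0// ltr1n.
have y01 : y0 < 1.
  have -> : y0 = expR (- (eta * ln 2)).
    rewrite /y0 -powR12_sqrt// /powR gt_eqF// /x0 -expRD /r; congr expR; ring.
  by rewrite expR_lt1 oppr_lt0 mulr_gt0.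
have y00 : 0 <= y0 by rewrite /y0 mulr_ge0 ?expR_ge0 ?sqrtr_ge0.
pose Q j n := (x0 ^+ j)%:C * signed_block (bl j) (eps j) n.
have Qs j : supp_lt (2 ^ j.+1) (Q j).
  by move=> n /bl0 h; rewrite /Q /signed_block h mulr0.
have Qc j : dnorm lam p (Q j) <= C * Num.sqrt 2 * y0 ^+ j.
  have s : supp_lt (2 ^ j.+1) (signed_block (bl j) (eps j)).
    by move=> n /bl0 h; rewrite /signed_block h.
  apply: (le_trans (@dnormZ _ lam _ _ p (x0 ^+ j)%:C p1 s)).
  rewrite normc_real ger0_norm ?exprn_ge0 ?expR_ge0//.
  apply: (@le_trans _ _ (x0 ^+ j * (C * Num.sqrt (2 ^ j.+1)%:R))).
    by apply: ler_wpM2l; [rewrite exprn_ge0 ?expR_ge0|exact: (Heps j).2].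
  have -> : Num.sqrt (2 ^ j.+1)%:R = Num.sqrt 2 ^+ j.+1 :> R.
    rewrite natrX; elim: j.+1 => [|k IH]; first by rewrite !expr0 sqrtr1.
    by rewrite !exprS sqrtrM// IH.
  by rewrite /y0 exprMn exprS; lra.
have cB K : \sum_(k < K) C * Num.sqrt 2 * y0 ^+ k <= C * Num.sqrt 2 * (1 - y0)^-1.
  rewrite -mulr_sumr; apply: ler_wpM2l; last exact: geometric_bounded.
  by rewrite mulr_ge0 ?sqrtr_ge0 ?ltW.
have Qs' k : exists N, supp_lt N (Q k) by exists (2 ^ k.+1)%N.
have [a ha aQ] := hardy_sum hlam p1 Qs' Qc cB.
(* The blocks are disjoint, so coefficient [n] of the partial sums has modulus
   [x0 ^+ j = 2^(- r * j)] once its block is included, and [2^j <= n + 1]. *)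
have alow n : expR (- (r * ln n.+1%:R)) <= nc (a n).
  pose j := trunc_log 2 n.+1.
  have jn : ((2 ^ j)%:R : R) <= n.+1%:R by rewrite ler_nat trunc_logP.
  have SQ K : (j < K)%N -> nc (\sum_(k < K) Q k n) = x0 ^+ j.
    move=> jK; rewrite (bigD1 (Ordinal jK))//= big1 ?addr0; last first.
      move=> i ij; rewrite /Q /signed_block /bl -/j ifF ?mulr0//.
      by apply/negbTE; apply: contra ij => /eqP ji; apply/eqP/val_inj.
    rewrite /Q /signed_block /bl -/j eqxx ComplexField.Normc.normcM.
    rewrite normc_real ger0_norm ?exprn_ge0 ?expR_ge0//.
    suff -> : nc (eps j n)%:C = 1 by rewrite mulr1.
    by rewrite normc_real; have [->|->] := (Heps j).1 n; rewrite ?normrN normr1.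
  apply: (@le_trans _ _ (x0 ^+ j)).
    rewrite /x0 -expRM_natl ler_expR mulrN lerN2 mulrCA.
    apply: ler_wpM2l; first by rewrite /r; lra.
    rewrite mulr_natl -lnXn// ler_ln ?posrE ?exprn_gt0 ?ltr0n//.
    by rewrite -natrX.
  apply: le_addgt0 => e e0.
  have /cvgrPdist_lt/(_ _ e0) [K0 _ HK] := aQ n.
  pose K := maxn K0 j.+1.
  have := HK K (leq_maxl _ _); rewrite sub0r normrN ger0_norm ?normc_ge0// => h.
  rewrite -(SQ K (leq_maxr _ _)).
  have -> : \sum_(k < K) Q k n = a n + (\sum_(k < K) Q k n - a n) by rewrite addrC subrK.
  by apply: (le_trans (normcD _ _)); rewrite lerD2l ltW.
have : abs_bounded lam a sg.
  apply: sigma_a_lt => //; apply: (@le_lt_trans _ _ v%:E); last by rewrite lte_fin.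
  exact: le_trans (sigma_a_le_S_p hlam p1 ha) Sv.
move=> [B HB].
have Bpos : 0 <= B by have := HB 0%N; rewrite big_ord0.
(* From this index on [eta * ln (n + 1)], and all the more [(n + 1)^eta], exceeds [B]. *)
pose n0 := Num.truncn (expR (B / eta)).
have [n [n0n n_gt0 hn]] := freqL_gt lL n0.
have nB : B < eta * ln n.+1%:R.
  rewrite -ltr_pdivrMl// mulrC -ltr_expR lnK ?posrE ?ltr0n//.
  apply: (lt_le_trans (truncnS_gt _)); rewrite ler_nat ltnS; exact: n0n.
have := HB n.+1; apply/negP; rewrite -ltNge; apply: (lt_le_trans nB).
apply: (@le_trans _ _ (expR (eta * ln n.+1%:R))).
  by apply: le_trans (expR_ge1Dx _); rewrite lerDr.
apply: (@le_trans _ _ (\sum_(i < n.+1) expR (- (r * ln n.+1%:R) - lam n * sg))).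
  have -> : \sum_(i < n.+1) expR (- (r * ln n.+1%:R) - lam n * sg) =
      expR (ln n.+1%:R) * expR (- (r * ln n.+1%:R) - lam n * sg).
    by rewrite sumr_const card_ord lnK ?posrE ?ltr0n// mulr_natl.
  rewrite -expRD ler_expR.
  have : sg / l * (l * lam n) <= sg / l * ln n.+1%:R.
    by apply: ler_wpM2l; [rewrite divr_ge0//; lra|exact: ltW].
  have -> : sg / l * (l * lam n) = lam n * sg by field; rewrite gt_eqF.
  have -> : r = 1 - sg / l - eta by rewrite /r /eta; field; rewrite gt_eqF.
  lra.
apply: ler_sum => i _; rewrite expRD.
apply: ler_pM; rewrite ?expR_ge0//.
  apply: le_trans (alow i); rewrite ler_expR lerN2.
  apply: ler_wpM2l; first by rewrite /r; lra.
  by rewrite ler_ln ?posrE ?ltr0n// ler_nat.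
rewrite ler_expR lerN2; apply: ler_wpM2r; first by lra.
by apply: (frequency_le hlam); rewrite -ltnS.
Qed.

Lemma S_2_le (L : R) : freqL lam = L%:E -> (S_p lam 2 <= (L / 2)%:E)%E.
Proof.
move=> LE; have L0 : 0 <= L by have := freqL_ge0; rewrite LE.
have two1 : 1 <= 2 :> R by lra.
apply: (S_p_le hlam two1); first by rewrite divr_ge0.
move=> a /(hardy_bounded two1)[P [M [Ps PM Pa]]].
have a2 N : \sum_(i < N) nc (a i) ^+ 2 <= M ^+ 2.
  have cv : \sum_(i < N) (nc (P k i) ^+ 2) @[k --> \oo] --> \sum_(i < N) (nc (a i) ^+ 2).
    apply: (@cvg_sum_ord _ N (fun i k => nc (P k i) ^+ 2) (fun i => nc (a i) ^+ 2)) => i.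
    have cv1 : nc (P k i) @[k --> \oo] --> nc (a i).
      apply/cvgrPdist_le => e e0; have /cvgrPdist_le/(_ _ e0) := Pa i.
      apply: filterS => k; rewrite sub0r normrN ger0_norm ?normc_ge0//; apply: le_trans.
      by rewrite distrC; exact: dist_normc_le.
    by under eq_fun do rewrite expr2; rewrite expr2; exact: cvgM.
  apply: (ler_cvg_to cv (@cvg_cst _ (M ^+ 2) _ \oo _)); near=> k.
  have [Nk hk] := Ps k.
  have hk' : supp_lt (maxn N Nk) (P k) by apply: supp_ltW hk; exact: leq_maxr.
  have P0 : 0 <= dnorm lam 2 (P k) by exact: (@dnorm_ge0 _ lam (maxn N Nk)).
  apply: (@le_trans _ _ (dnorm lam 2 (P k) ^+ 2)).
    rewrite (dnorm2 (frequency_inj hlam) hk').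
    rewrite (big_ord_widen (maxn N Nk) (fun i => nc (P k i) ^+ 2)) ?leq_maxl//.
    rewrite [leRHS](bigID (fun i : 'I_(maxn N Nk) => (i < N)%N))/= lerDl.
    by apply: sumr_ge0 => i _; exact: sqr_ge0.
  by rewrite lerXn2r ?nnegrE ?PM// (le_trans P0).
apply/(sigma_a_leP hlam) => e e0.
have hl : (freqL lam < (L + e)%:E)%E by rewrite LE lte_fin; lra.
(* The exponent is twice the target [L / 2 + e], so that Cauchy-Schwarz can be applied termwise as
   [2 * x * y <= x^2 + y^2]. *)
have [B HB] := @sum_exp_frequency (L + e) (L + 2 * e) hl (ltac:(lra)) (ltac:(lra)).
exists (2^-1 * (M ^+ 2 + B)) => N.
apply: (@le_trans _ _ (\sum_(i < N) 2^-1 * (nc (a i) ^+ 2 + expR (- (lam i * (L + 2 * e)))))).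
  apply: ler_sum => i _.
  have -> : expR (- (lam i * (L + 2 * e))) = expR (- (lam i * (L / 2 + e))) ^+ 2.
    by rewrite -expRM_natl; congr expR; field.
  move: (nc (a i)) (expR _) => x y.
  have := sqr_ge0 (x - y); rewrite sqrrB; lra.
rewrite -mulr_sumr big_split/=; apply: ler_wpM2l; first by rewrite invr_ge0.
by apply: lerD; [exact: a2|exact: HB].
Unshelve. all: by end_near. Qed.

End ExponentOfConvergence.

(** * Gaussian decomposition and the comparison of [S_p] with [S_q] *)

Section Interpolation.
Context {R : realType} (lam : nat -> R).
Local Open Scope complex_scope.
Local Notation nc := (@ComplexField.Normc.normc R).
Implicit Types (a b : nat -> R[i]) (N : nat) (p q : R).
Hypothesis hlam : frequency lam.

Lemma bounded_sum_tail (t : nat -> R) (B : R) : (forall i, 0 <= t i) ->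
  (forall N, \sum_(i < N) t i <= B) -> forall e : R, 0 < e ->
  exists N0, forall N, \sum_(i < N) t i <= \sum_(i < N0) t i + e.
Proof.
move=> t0 tB e e0.
pose E := [set x | exists N, x = \sum_(i < N) t i].
have hE : has_sup E.
  by split; [exists (\sum_(i < 0) t i); exists 0%N|exists B => _ [N ->]].
have [_ [N0 ->] h] := sup_adherent e0 hE.
exists N0 => N; have : \sum_(i < N) t i <= sup E by apply: sup_upper_bound => //; exists N.
lra.
Qed.

Lemma le_sum_ord (t : nat -> R) N N' : (forall i, 0 <= t i) -> (N <= N')%N ->
  \sum_(i < N) t i <= \sum_(i < N') t i.
Proof.
move=> t0 NN'; rewrite -subr_ge0 sum_ord_diff//.
by apply: sumr_ge0 => i _.
Qed.

Definition gauss_weight (k n : nat) : R := expR (- ((lam n - k%:R) ^+ 2 / 2)).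

(** Completing the square: this is [(lam n - k - u)^2 >= 0]. It converts a convergent sum at
    abscissa [u] into absolute sums of the pieces of order [exp(u k)]. *)
Lemma gauss_weight_le k n (u : R) :
  gauss_weight k n <= expR (u ^+ 2 / 2 + u * k%:R) * expR (- (lam n * u)).
Proof.
rewrite /gauss_weight -expRD ler_expR.
have := sqr_ge0 (lam n - k%:R - u); move: (lam n) (k%:R : R) => x y; nra.
Qed.

(** For [k] the integer part of [lam n], the distance [lam n - k] is at most 1, so this single piece
    already retains a fixed share of the coefficient. *)
Lemma gauss_weight_ge n (w : R) : 0 <= w ->
  expR (- 2^-1) * expR (- (lam n * w)) <=
  expR (- (w * (Num.truncn (lam n))%:R)) * gauss_weight (Num.truncn (lam n)) n.
Proof.
move=> w0; have /andP[k1 k2] := truncn_itv (frequency_ge0 hlam n).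
rewrite -natr1 in k2; move: (Num.truncn (lam n)) k1 k2 => k k1 k2.
rewrite /gauss_weight -!expRD ler_expR.
have : w * k%:R <= lam n * w by rewrite mulrC ler_wpM2r.
have : (lam n - k%:R) ^+ 2 <= 1 by rewrite expr_le1//; lra.
lra.
Qed.

(* The element of [H_q] is the sum over [k] of [exp(- w k)] times the Gaussian pieces
   of an approximant [P (jj k)] of [D], chosen so that the coefficients of the
   k-th piece are within total distance 1 of those of the piece of [D]. *)
Lemma interpolation_step p q (s u tau d : R) a : 1 <= p -> p <= q ->
  0 <= s -> (S_p lam q <= s%:E)%E -> 0 <= u -> 0 < d ->
  (exists B : R, forall N, \sum_(i < N) expR (- (lam i * tau)) <= B) ->
  hardy lam p a -> abs_bounded lam a u ->
  abs_bounded lam a ((1 - p / q) * u + d + (s + d)).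
Proof.
move=> p1 pq s0 Sq u0 d0 [Bt HBt] /(hardy_bounded p1)[P [M [Ps PM Pa]]] [A HA].
have p0 : 0 < p by lra.
have q0 : 0 < q by lra.
have q1 : 1 <= q by lra.
have M0 : 0 <= M.
  by have [N hN] := Ps 0%N; apply: le_trans (PM 0%N); exact: (@dnorm_ge0 _ lam N).
have A0 : 0 <= A by have := HA 0%N; rewrite big_ord0.
have PcM k n : nc (P k n) <= M.
  have [N hN] := Ps k; apply: le_trans (PM k).
  exact: (@coef_le_dnorm _ lam (frequency_inj hlam) N).
pose g := gauss_weight.
have g0 k n : 0 <= g k n by exact: expR_ge0.
have aM n : nc (a n) <= M.
  apply: le_addgt0 => e e0; have /cvgrPdist_le/(_ _ e0)[k0 _ Hk] := Pa n.
  have := Hk k0 (leqnn _); rewrite sub0r normrN ger0_norm ?normc_ge0// => h.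
  have := dist_normc_le (P k0 n) (a n); rewrite ler_norml; have := PcM k0 n; lra.
(* Dominated convergence: all coefficients are at most [M] and the weight is
   [O(exp(- tau * lam i))], so a tail is at most 1/2 uniformly in [j]; the finite head is at most
   1/2 for a suitable [j]. *)
have J k : exists j, forall N, \sum_(i < N) nc (P j i - a i) * g k i <= 1.
  pose T : R := 2 * M * expR (tau ^+ 2 / 2 + tau * k%:R).
  pose t i := T * expR (- (lam i * tau)).
  have T0 : 0 <= T by rewrite !mulr_ge0 ?expR_ge0.
  have t0 i : 0 <= t i by rewrite mulr_ge0 ?expR_ge0.
  have tB N : \sum_(i < N) t i <= T * Bt.
    by rewrite -mulr_sumr; apply: ler_wpM2l.
  have h2 : 0 < 2^-1 :> R by rewrite invr_gt0.
  have [N0 HN0] := bounded_sum_tail t0 tB h2.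
  have cv : \sum_(i < N0) nc (P j i - a i) @[j --> \oo] --> \sum_(i < N0) (0 : R).
    exact: (@cvg_sum_ord _ N0 (fun i j => nc (P j i - a i)) (fun=> 0)).
  rewrite big1// in cv.
  have /cvgr0Pnorm_le/(_ _ h2)[j _ Hj] := cv.
  have hj : \sum_(i < N0) nc (P j i - a i) <= 2^-1.
    exact: le_trans (ler_norm _) (Hj j (leqnn _)).
  exists j => N.
  pose f i := nc (P j i - a i) * g k i.
  have f0 i : 0 <= f i by rewrite mulr_ge0 ?normc_ge0.
  have ft i : f i <= t i.
    rewrite /f /t /T -mulrA; apply: ler_pM; rewrite ?normc_ge0//; last exact: gauss_weight_le.
    apply: (le_trans (normcD _ _)); rewrite normcN.
    by have := PcM j i; have := aM i; lra.
  apply: (le_trans (@le_sum_ord f N (maxn N N0) f0 (leq_maxl _ _))).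
  have e1 := sum_ord_diff f (leq_maxr N N0).
  have e2 := sum_ord_diff t (leq_maxr N N0).
  have h3 : \sum_(i < maxn N N0 - N0) f (N0 + i)%N <= \sum_(i < maxn N N0 - N0) t (N0 + i)%N.
    by apply: ler_sum => i _.
  have h4 : \sum_(i < N0) f i <= 2^-1.
    apply: le_trans hj; apply: ler_sum => i _; rewrite /f.
    apply: ler_piMr; first exact: normc_ge0.
    by rewrite expR_le1 oppr_le0 divr_ge0// sqr_ge0.
  have := HN0 (maxn N N0); rewrite -e1 -e2 in h3; lra.
have /choice[jj Hjj] := J.
pose th := 1 - p / q.
have th0 : 0 <= th by rewrite /th subr_ge0 ler_pdivrMr// mul1r.
pose w := th * u + d.
have w0 : 0 < w by rewrite /w; have := mulr_ge0 th0 u0; lra.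
pose G k n := (g k n)%:C * P (jj k) n.
have Gs k : exists N, supp_lt N (G k).
  by have [N hN] := Ps (jj k); exists N => n Nn; rewrite /G hN ?mulr0.
(* The 1 pays for replacing [D] by its approximant, the rest is the absolute sum of the piece of [D]
   up to the factor [exp(u k)]. *)
pose A' := 1 + expR (u ^+ 2 / 2) * A.
have A'0 : 0 <= A' by rewrite addr_ge0 ?mulr_ge0 ?expR_ge0.
have ncg k n (z : R[i]) : nc ((g k n)%:C * z) = nc z * g k n.
  by rewrite ComplexField.Normc.normcM normc_real ger0_norm// mulrC.
have Gl1 k N : \sum_(i < N) nc (G k i) <= A' * expR (u * k%:R).
  apply: (@le_trans _ _ (\sum_(i < N) (nc (P (jj k) i - a i) * g k i + nc (a i) * g k i))).
    apply: ler_sum => i _; rewrite /G ncg -mulrDl; apply: ler_wpM2r => //.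
    by have := normcD (P (jj k) i - a i) (a i); rewrite subrK.
  rewrite big_split/= /A' mulrDl mul1r; apply: lerD.
    apply: (le_trans (Hjj k N)); rewrite -expR0 ler_expR mulr_ge0//.
  apply: (@le_trans _ _ (\sum_(i < N) expR (u ^+ 2 / 2 + u * k%:R) *
      (nc (a i) * expR (- (lam i * u))))).
    apply: ler_sum => i _; rewrite mulrCA; apply: ler_wpM2l; first exact: normc_ge0.
    exact: gauss_weight_le.
  rewrite -mulr_sumr expRD [leRHS]mulrAC; apply: ler_wpM2l; last exact: HA.
  by rewrite mulr_ge0 ?expR_ge0.
have Gp k : dnorm lam p (G k) <= M.
  have [N hN] := Ps (jj k); apply: le_trans (PM (jj k)).
  exact: (@gauss_multiplier _ lam N (P (jj k)) p k%:R p1 hN).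
(* The q-th root of the interpolation inequality, whose exponents become [(q - p) / q = th] and
   [p / q]. *)
pose c0 := A' `^ th * M `^ (p / q).
have Gq k : dnorm lam q (G k) <= c0 * expR (th * u * k%:R).
  have [N hN] := Gs k.
  have D0 : 0 <= dnorm lam q (G k) by exact: (@dnorm_ge0 _ lam N).
  have D0' : 0 <= dnorm lam p (G k) by exact: (@dnorm_ge0 _ lam N).
  have := @dnorm_interpolation _ lam N (G k) p q _ p1 pq hN (Gl1 k N).
  move: (dnorm lam q (G k)) (dnorm lam p (G k)) D0 D0' (Gp k) => x y x0 y0 yM h.
  have -> : x = (x `^ q) `^ q^-1 by rewrite -powRrM divff ?gt_eqF// powRr1.
  apply: (@le_trans _ _ (((A' * expR (u * k%:R)) `^ (q - p) * M `^ p) `^ q^-1)).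
    apply: ge0_ler_powR; rewrite ?nnegrE ?powR_ge0 ?mulr_ge0 ?powR_ge0 ?invr_ge0 ?(ltW q0)//.
    apply: (le_trans h); apply: ler_wpM2l; first exact: powR_ge0.
    by apply: ge0_ler_powR; rewrite ?nnegrE ?(ltW p0).
  rewrite powRM ?powR_ge0// -!powRrM.
  have -> : (q - p) / q = th by rewrite /th; field; rewrite gt_eqF.
  rewrite powRM ?expR_ge0// -expRM /c0.
  have -> : u * k%:R * th = th * u * k%:R by ring.
  by rewrite mulrAC.
pose Q k n := (expR (- (w * k%:R)))%:C * G k n.
have Qs k : exists N, supp_lt N (Q k).
  by have [N hN] := Gs k; exists N => n Nn; rewrite /Q hN ?mulr0.
have c00 : 0 <= c0 by rewrite /c0 mulr_ge0 ?powR_ge0.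
have Qc k : dnorm lam q (Q k) <= c0 * expR (- d) ^+ k.
  have [N hN] := Gs k.
  apply: (le_trans (@dnormZ _ lam N _ q _ q1 hN)).
  rewrite normc_real ger0_norm ?expR_ge0//.
  apply: (@le_trans _ _ (expR (- (w * k%:R)) * (c0 * expR (th * u * k%:R)))).
    by apply: ler_wpM2l => //; exact: expR_ge0.
  rewrite mulrCA -expRD -expRM_natl /w.
  have -> : - ((th * u + d) * k%:R) + th * u * k%:R = k%:R * (- d) by ring.
  by [].
have ed1 : expR (- d) < 1 by rewrite expR_lt1 oppr_lt0.
have ew1 : expR (- w) < 1 by rewrite expR_lt1 oppr_lt0.
have cB K : \sum_(k < K) c0 * expR (- d) ^+ k <= c0 * (1 - expR (- d))^-1.
  by rewrite -mulr_sumr; apply: ler_wpM2l => //; apply: geometric_bounded => //; exact: expR_ge0.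
have [b hb bQ] := hardy_sum hlam q1 Qs Qc cB.
have [B1 HB1] : abs_bounded lam b (s + d).
  apply: sigma_a_lt; apply: (@le_lt_trans _ _ s%:E); last by rewrite lte_fin ltrDl.
  exact: le_trans (sigma_a_le_S_p hlam q1 hb) Sq.
pose C2 := (1 - expR (- w))^-1.
have HC2 K : \sum_(k < K) expR (- (w * k%:R)) <= C2.
  have -> : \sum_(k < K) expR (- (w * k%:R)) = \sum_(k < K) expR (- w) ^+ k.
    by apply: eq_bigr => k _; rewrite -expRM_natl; congr expR; ring.
  by apply: geometric_bounded => //; exact: expR_ge0.
exists (expR (2^-1) * (B1 + 1 + C2)) => N.
have cvN : \sum_(i < N) nc (\sum_(k < K) Q k i - b i) @[K --> \oo] --> \sum_(i < N) (0 : R).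
  exact: (@cvg_sum_ord _ N (fun i K => nc (\sum_(k < K) Q k i - b i)) (fun=> 0)).
rewrite big1// in cvN.
have /cvgr0Pnorm_le/(_ _ ltr01)[K0 _ HK0] := cvN.
(* Large enough that for each [i < N] the piece numbered by the integer part of [lam i] occurs in
   the partial sum. *)
pose K := maxn K0 (Num.truncn (lam N)).+1.
have hK : \sum_(i < N) nc (\sum_(k < K) Q k i - b i) <= 1.
  by apply: le_trans (ler_norm _) (HK0 K _); exact: leq_maxl.
have v0 : 0 <= s + d by lra.
pose err i := \sum_(k < K) expR (- (w * k%:R)) * (nc (P (jj k) i - a i) * g k i).
have errN : \sum_(i < N) err i <= C2.
  rewrite /err exchange_big/=; apply: le_trans (HC2 K); apply: ler_sum => k _.
  rewrite -mulr_sumr; apply: ler_piMr; first exact: expR_ge0.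
  exact: Hjj.
(* Coefficient [i] of the partial sum is [theta * a i] up to [err i], and [theta] is at least
   [exp(- 1/2) * exp(- w * lam i)]; positivity of the weights rules out cancellation, so [a i] is
   recovered from [b i]. *)
have point i : (i < N)%N -> expR (- 2^-1) * (nc (a i) * expR (- (lam i * (w + (s + d))))) <=
    nc (b i) * expR (- (lam i * (s + d))) + nc (\sum_(k < K) Q k i - b i) + err i.
  move=> iN.
  pose theta := \sum_(k < K) expR (- (w * k%:R)) * g k i.
  have tr : (Num.truncn (lam i) < K)%N.
    rewrite /K leq_max ltnS; apply/orP; right.
    by apply: le_truncn; apply: (frequency_le hlam); exact: ltnW.
  have thge : expR (- 2^-1) * expR (- (lam i * w)) <= theta.
    apply: (le_trans (gauss_weight_ge i (ltW w0))).
    rewrite /theta (bigD1 (Ordinal tr))//= lerDl.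
    by apply: sumr_ge0 => k _; rewrite mulr_ge0 ?expR_ge0.
  have QE : \sum_(k < K) Q k i = theta%:C * a i +
      \sum_(k < K) (expR (- (w * k%:R)) * g k i)%:C * (P (jj k) i - a i).
    rewrite /theta rmorph_sum mulr_suml -big_split/=; apply: eq_bigr => k _.
    by rewrite -mulrDr subrKC /Q /G mulrA -rmorphM.
  have h1 : nc (a i) * theta <= nc (\sum_(k < K) Q k i) + err i.
    have t0 : 0 <= theta by apply: sumr_ge0 => k _; rewrite mulr_ge0 ?expR_ge0.
    have -> : nc (a i) * theta = nc (theta%:C * a i).
      by rewrite ComplexField.Normc.normcM normc_real ger0_norm// mulrC.
    have -> : theta%:C * a i = \sum_(k < K) Q k i +
        - \sum_(k < K) (expR (- (w * k%:R)) * g k i)%:C * (P (jj k) i - a i).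
      by rewrite QE addrK.
    apply: (le_trans (normcD _ _)); rewrite lerD2l normcN.
    apply: (le_trans (normc_sum _ _ _)); apply: ler_sum => k _.
    rewrite ComplexField.Normc.normcM normc_real ger0_norm ?mulr_ge0 ?expR_ge0//.
    by rewrite -mulrA [g k i * _]mulrC.
  have h2 : nc (\sum_(k < K) Q k i) <= nc (b i) + nc (\sum_(k < K) Q k i - b i).
    by have := normcD (b i) (\sum_(k < K) Q k i - b i); rewrite subrKC.
  have -> : expR (- 2^-1) * (nc (a i) * expR (- (lam i * (w + (s + d))))) =
      nc (a i) * (expR (- 2^-1) * expR (- (lam i * w))) * expR (- (lam i * (s + d))).
    by rewrite mulrDr opprD expRD; ring.
  have E1 : expR (- (lam i * (s + d))) <= 1.
    by rewrite expR_le1 oppr_le0 mulr_ge0// (frequency_ge0 hlam).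
  have E0 : 0 <= expR (- (lam i * (s + d))) by exact: expR_ge0.
  apply: (@le_trans _ _ ((nc (b i) + nc (\sum_(k < K) Q k i - b i) + err i) * expR (- (lam i *
    (s + d))))).
    apply: ler_wpM2r => //; apply: (@le_trans _ _ (nc (a i) * theta)).
      by apply: ler_wpM2l => //; exact: normc_ge0.
    by apply: (le_trans h1); rewrite lerD2r.
  have err0 : 0 <= err i.
    by apply: sumr_ge0 => k _; rewrite !mulr_ge0 ?expR_ge0 ?normc_ge0.
  rewrite -addrA mulrDl -[leRHS]addrA lerD2l.
  by apply: ler_piMr => //; rewrite addr_ge0 ?normc_ge0.
have tot : expR (- 2^-1) * \sum_(i < N) nc (a i) * expR (- (lam i * (w + (s + d)))) <=
    B1 + 1 + C2.
  rewrite mulr_sumr.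
  apply: (@le_trans _ _ (\sum_(i < N) (nc (b i) * expR (- (lam i * (s + d))) +
     nc (\sum_(k < K) Q k i - b i) + err i))).
    by apply: ler_sum => i _; exact: point.
  rewrite !big_split/=; apply: lerD => //; apply: lerD => //; exact: HB1.
have -> : expR 2^-1 = (expR (- 2^-1))^-1 :> R by rewrite expRN invrK.
by rewrite ler_pdivlMl ?expR_gt0.
Qed.

(** Above the fixed point [q / p * s] the map [u -> (1 - p / q) * u + s] strictly decreases [u], so
    the infimum of the admissible abscissas cannot lie above it. *)
Lemma sigma_a_interpolation p q (s : R) a : 1 <= p -> p <= q -> 0 <= s ->
  (S_p lam q <= s%:E)%E -> hardy lam p a -> (sigma_a lam a <= (q / p * s)%:E)%E.
Proof.
move=> p1 pq s0 Sq ha.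
have p0 : 0 < p by lra.
have q0 : 0 < q by lra.
have q1 : 1 <= q by lra.
have Lq := freqL_le_S_p hlam q1 s0 Sq.
have hl : (freqL lam < (2 * s + 1)%:E)%E by apply: (le_lt_trans Lq); rewrite lte_fin ltrDl.
have Ht := sum_exp_frequency hlam hl (ltac:(lra)) (ltac:(lra) : 2 * s + 1 < 2 * s + 2).
(* Unlike [sigma_a], the infimum of [E] is certainly finite: [E] is bounded below by 0, and it is
   inhabited because [S_q <= s] forces [L <= 2 * s] and the coefficients are bounded. *)
pose E := [set u : R | 0 <= u /\ abs_bounded lam a u].
have Ene : E (2 * s + 2).
  split; first by lra.
  have [P [M [Ps PM Pa]]] := hardy_bounded p1 ha.
  have [B HB] := Ht.
  have aM n : nc (a n) <= M.
    apply: le_addgt0 => e e0; have /cvgrPdist_le/(_ _ e0)[k0 _ Hk] := Pa n.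
    have := Hk k0 (leqnn _); rewrite sub0r normrN ger0_norm ?normc_ge0// => h.
    have hP : nc (P k0 n) <= M.
      have [N hN] := Ps k0; apply: le_trans (PM k0).
      exact: (@coef_le_dnorm _ lam (frequency_inj hlam) N).
    have := dist_normc_le (P k0 n) (a n); rewrite ler_norml; lra.
  have M0 : 0 <= M by exact: le_trans (normc_ge0 _) (aM 0%N).
  exists (M * B) => N.
  apply: (@le_trans _ _ (\sum_(i < N) M * expR (- (lam i * (2 * s + 2))))).
    by apply: ler_sum => i _; apply: ler_wpM2r => //; exact: expR_ge0.
  by rewrite -mulr_sumr; exact: ler_wpM2l.
have Einf : has_inf E by split; [exists (2 * s + 2)|exists 0 => u []].
apply/(sigma_a_leP hlam) => e e0.
set v := q / p * s + e.
have [[u [uE uv]]|noE] := pselect (exists u, E u /\ u <= v).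
  exact: (abs_boundedW hlam uv uE.2).
have vE : v <= inf E.
  apply: lb_le_inf; first by exists (2 * s + 2).
  move=> u uE; rewrite leNgt; apply/negP => uv; apply: noE.
  by exists u; split => //; exact: ltW.
pose rho := p / q.
have rho0 : 0 < rho by rewrite divr_gt0.
have rho1 : rho <= 1 by rewrite /rho ler_pdivrMr// mul1r.
(* The step from a [u] within [d] of the infimum loses [2 * d + (1 - rho) * d], less than the
   available margin [rho * e = 4 * d]. *)
pose d := e * rho / 4.
have d0 : 0 < d by rewrite /d !mulr_gt0// invr_gt0.
have [u uE ud] := inf_adherent d0 Einf.
have [u0 bu] := uE.
have step := interpolation_step p1 pq s0 Sq u0 d0 Ht ha bu.
rewrite -/rho in step.
have u'E : E ((1 - rho) * u + d + (s + d)).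
  split=> //; have : 0 <= (1 - rho) * u by rewrite mulr_ge0 ?subr_ge0.
  lra.
have h1 : inf E <= (1 - rho) * u + d + (s + d) by apply: inf_lbound => //; exact: Einf.2.
have h2 : (1 - rho) * u <= (1 - rho) * (inf E + d).
  by apply: ler_wpM2l; [rewrite subr_ge0|exact: ltW].
have h3 : rho * v <= rho * inf E by apply: ler_wpM2l => //; exact: ltW.
have h4 : rho * v = s + 4 * d.
  by rewrite /v /d /rho; field; rewrite !gt_eqF.
have h5 : 0 <= rho * d by rewrite mulr_ge0 ?ltW.
exfalso; move: h1 h2 h3 h4 h5 d0; clear; move: (inf E) => I; lra.
Qed.

End Interpolation.

(** * Almost everywhere differentiability *)

Section LipschitzDerivable.
Context {R : realType}.
Local Notation mu := (@lebesgue_measure R).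

Section stieltjes_domination.
Variables (F : R -> R).
Hypothesis F_nd : forall x y, x <= y -> F x <= F y <= F x + (y - x).

Let F_homo : {homo F : x y / x <= y}.
Proof. by move=> x y /F_nd/andP[]. Qed.

Let G x := x - F x.

Let G_homo : {homo G : x y / x <= y}.
Proof. by move=> x y /F_nd/andP[h1 h2]; rewrite /G; lra. Qed.

Let F_cont : continuous F.
Proof.
move=> x; apply/cvgrPdist_le => e e0; near=> y.
apply: (@le_trans _ _ `|x - y|); last by near: y; exact: cvgr_dist_le.
have [xy|yx] := leP x y.
  have /andP[h1 h2] := F_nd xy.
  rewrite ler0_norm ?subr_le0// ler0_norm ?subr_le0//; lra.
have /andP[h1 h2] := F_nd (ltW yx).
rewrite ger0_norm ?subr_ge0// ger0_norm ?subr_ge0 ?(ltW yx)//; lra.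
Unshelve. all: by end_near. Qed.

Let G_cont : continuous G.
Proof. by move=> x; apply: cvgB; [exact: cvg_id|exact: F_cont]. Qed.

HB.instance Definition _ := isCumulative.Build R _ R F F_homo (right_continuousW F_cont).
HB.instance Definition _ := isCumulative.Build R _ R G G_homo (right_continuousW G_cont).

Let muF := lebesgue_stieltjes_measure F.
Let muG := lebesgue_stieltjes_measure G.

Lemma stieltjes_itv (x y : R) : x <= y -> muF `]x, y] = (F y - F x)%:E.
Proof.
move=> xy; rewrite /muF /lebesgue_stieltjes_measure /measure_extension measurable_mu_extE/=;
  last exact: is_ocitv.
by rewrite wlength_itv_bnd.
Qed.

Lemma stieltjes_itvG (x y : R) : x <= y -> muG `]x, y] = (G y - G x)%:E.
Proof.
move=> xy; rewrite /muG /lebesgue_stieltjes_measure /measure_extension measurable_mu_extE/=;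
  last exact: is_ocitv.
by rewrite wlength_itv_bnd.
Qed.

(* The Stieltjes measures of [F] and of [x - F x] add up to Lebesgue measure. *)
Lemma stieltjes_le_lebesgue A : measurable A -> (muF A <= mu A)%E.
Proof.
move=> mA; have E : mu A = measure_add muF muG A.
  apply: (@lebesgue_measure_unique R (measure_add muF muG)) => // X.
  move=> /ocitvP[->|[[x y] /= xy ->]]; first by rewrite !measure0.
  transitivity (muF `]x, y] + muG `]x, y])%E; last exact/esym/measure_addE.
  rewrite (stieltjes_itv (ltW xy)) (stieltjes_itvG (ltW xy)).
  rewrite lebesgue_measure_itv/= lte_fin xy -!EFinD; congr EFin.
  by rewrite /G; ring.
by rewrite E measure_addE leeDl.
Qed.

(** Domination by Lebesgue measure gives absolute continuity, so on the interval [F - F a] is the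
    integral of a density. *)
Lemma ae_derivable_stieltjes (a b : R) : a < b ->
  {ae mu, forall x, a < x < b -> derivable F x 1}.
Proof.
move=> ab; pose D : set (measurableTypeR R) := `]a, b]%classic.
have mD : measurable D by exact: measurable_itv.
(* Restriction to a bounded interval makes the measure finite and therefore its density integrable
   on the line. *)
have D_fin : (muF D < +oo)%E by rewrite stieltjes_itv ?ltW// ltry.
pose nu : {finite_measure set (measurableTypeR R) -> \bar R} := mfrestr mD D_fin.
have nu_mu : nu `<< mu.
  move=> A A0 B mB BA; apply/eqP; rewrite eq_le measure_ge0 andbT.
  rewrite -(A0 B mB BA); apply: le_trans (stieltjes_le_lebesgue mB).
  by apply: le_measure; rewrite ?inE//; exact: measurableI.
have [f [f0 ffin intf fE]] := radon_nikodym_sigma_finite nu_mu.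
pose g : R -> R := fine \o f.
have gf : EFin \o g = f by apply/funext => x; rewrite /g/= fineK.
have ig : mu.-integrable setT (EFin \o g) by rewrite gf.
have igy (y : R) : mu.-integrable [set` Interval (BRight a) (BRight y)] (EFin \o g).
  by apply: (integrableS _ _ _ ig); [exact: measurableT|exact: measurable_itv|exact: subsetT].
have lg : locally_integrable setT g by apply: open_integrable_locally => //; exact: openT.
have FTC := FTC1 igy lg.
move: FTC; apply: filterS; first exact: (ae_filter_ringOfSetsType mu).
move=> x /= + /andP[ax xb] => /(_ ax)[dx _].
have key : {near x, (fun y => F a + \int[mu]_(t in [set` Interval (BRight a) (BRight y)]) g t)
  =1 F}.
  near=> y.
  have ay : a < y by near: y; exact: lt_nbhsr.
  have yb : y < b by near: y; exact: lt_nbhsl.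
  pose Dy : set (measurableTypeR R) := `]a, y]%classic.
  have DyE : nu Dy = (F y - F a)%:E.
    rewrite /nu /= /mfrestr /mrestr (_ : Dy `&` D = Dy); last first.
      apply/seteqP; split=> z; first by case.
      rewrite /Dy /D /= !in_itv/= => /andP[az zy].
      by rewrite az zy/= (le_trans zy (ltW yb)).
    exact: (stieltjes_itv (ltW ay)).
  have fD := fE Dy (measurable_itv _).
  rewrite DyE -gf in fD.
  by rewrite /Rintegral -[X in fine X]/(\int[mu]_(t in Dy) (EFin \o g) t)%E -fD /= addrC subrK.
apply: near_eq_derivable key _.
by apply: derivableD; [exact: derivable_cst|exact: dx].
Unshelve. all: by end_near. Qed.

End stieltjes_domination.

End LipschitzDerivable.

(** * Regularity of a decreasing [f] with [p * f p] increasing *)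

Section MonotoneProfile.
Context {R : realType} (f : R -> R).
Local Notation mu := (@lebesgue_measure R).
Hypothesis f_ge0 : forall p, 1 <= p <= 2 -> 0 <= f p.
Hypothesis f_dec : forall p q, 1 <= p -> p <= q -> q <= 2 -> f q <= f p.
Hypothesis pf_inc : forall p q, 1 <= p -> p <= q -> q <= 2 -> p * f p <= q * f q.

(** Rearranging [p * f p <= q * f q] gives [q * (f p - f q) <= f p * (q - p)]; then [q >= 1] and
    [f p <= f 1]. *)
Lemma profile_increment p q : 1 <= p -> p <= q -> q <= 2 ->
  0 <= f p - f q <= f 1 * (q - p).
Proof.
move=> p1 pq q2; rewrite subr_ge0 f_dec//=.
have q0 : 0 < q by lra.
have fp0 : 0 <= f p by apply: f_ge0; rewrite p1; lra.
have fp1 : f p <= f 1 by apply: f_dec; lra.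
have h := pf_inc p1 pq q2.
have h1 : q * (f p - f q) <= f p * (q - p) by lra.
have h2 : f p * (q - p) <= f 1 * (q - p) by apply: ler_wpM2r => //; lra.
have [h3|h3] := leP (f p - f q) 0.
  by apply: (le_trans h3); rewrite mulr_ge0//; lra.
apply: le_trans h2; apply: le_trans h1; rewrite ler_peMl//; lra.
Qed.

Lemma profile_lipschitz : [lipschitz f p | p in `[1, 2]].
Proof.
rewrite /lipschitz_on; near=> M.
have M1 : f 1 <= M by near: M; apply: nbhs_pinfty_ge; exact: num_real.
have f10 : 0 <= f 1 by apply: f_ge0; lra.
move=> [x y] /= [] /=; rewrite !in_itv/= => /andP[x1 x2] /andP[y1 y2].
have [xy|/ltW yx] := leP x y.
  have /andP[h1 h2] := profile_increment x1 xy y2.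
  rewrite ger0_norm// distrC ger0_norm ?subr_ge0//.
  by apply: (le_trans h2); apply: ler_wpM2r; rewrite ?subr_ge0.
have /andP[h1 h2] := profile_increment y1 yx x2.
rewrite distrC ger0_norm// ger0_norm ?subr_ge0//.
by apply: (le_trans h2); apply: ler_wpM2r; rewrite ?subr_ge0.
Unshelve. all: by end_near. Qed.

Lemma profile_ae_derivable : {ae mu, forall p, 1 < p < 2 -> derivable f p 1}.
Proof.
have f10 : 0 <= f 1 by apply: f_ge0; lra.
(* Changing the sign, dividing by [K] and clamping to the interval produce a non-decreasing function
   of Lipschitz constant 1 on the whole line. The added 1 keeps [K] positive when [f 1 = 0]. *)
pose K := f 1 + 1; have K0 : 0 < K by rewrite /K; lra.
pose clamp (y : R) := Num.max 1 (Num.min y 2).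
pose F y := - f (clamp y) / K.
have clampE x : [\/ x <= 1 /\ clamp x = 1, 1 <= x <= 2 /\ clamp x = x | 2 <= x /\ clamp x = 2].
  rewrite /clamp; have [x2|/ltW x2] := leP x 2; last by constructor 3; rewrite max_r//; lra.
  have [x1|/ltW x1] := leP 1 x; first by constructor 2; split=> //; lra.
  by constructor 1.
have clampP x y : x <= y -> [/\ 1 <= clamp x, clamp x <= clamp y, clamp y <= 2 &
    clamp y - clamp x <= y - x].
  by move=> xy; case: (clampE x) => -[? ->]; case: (clampE y) => -[? ->]; split; lra.
have F_nd x y : x <= y -> F x <= F y <= F x + (y - x).
  move=> /clampP[c1 c2 c3 c4].
  have /andP[h1 h2] := profile_increment c1 c2 c3.
  apply/andP; split.
    by rewrite /F ler_pM2r ?invr_gt0// lerN2 -subr_ge0.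
  have -> : F y = F x + (f (clamp x) - f (clamp y)) / K by rewrite /F; field; rewrite gt_eqF.
  rewrite lerD2l ler_pdivrMr//; apply: (le_trans h2).
  apply: (@le_trans _ _ (f 1 * (y - x))); first by apply: ler_wpM2l.
  rewrite mulrC; apply: ler_wpM2l; [lra|by rewrite /K lerDl].
have := ae_derivable_stieltjes F_nd (ltac:(lra) : (1 : R) < 2).
apply: filterS; first exact: (ae_filter_ringOfSetsType mu).
move=> p /= + /andP[p1 p2]; rewrite p1 p2 => /(_ isT) dF.
have key : {near p, (fun y => - K * F y) =1 f}.
  near=> y; rewrite /F.
  have y1 : 1 <= y by apply/ltW; near: y; exact: lt_nbhsr.
  have y2 : y <= 2 by apply/ltW; near: y; exact: lt_nbhsl.
  have -> : clamp y = y by rewrite /clamp min_l// max_r.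
  by field; rewrite gt_eqF.
apply: near_eq_derivable key _.
exact: derivableM (derivable_cst _ _ _) dF.
Unshelve. all: by end_near. Qed.

(** As the derivative exists, right difference quotients decide: [p * (f (p + h) - f p) >= - h * f
    (p + h) >= - h * f p]. *)
Lemma profile_derive_bounds p : 1 < p < 2 -> derivable f p 1 ->
  - (f p / p) <= derive1 f p /\ derive1 f p <= 0.
Proof.
move=> /andP[p1 p2] df; have p0 : 0 < p by lra.
have hl : h^-1 *: ((f \o shift p) (h *: 1) - f p) @[h --> (0:R)^'] --> derive1 f p.
  by rewrite derive1E; exact: df.
have hr : h^-1 *: ((f \o shift p) (h *: 1) - f p) @[h --> (0:R)^'+] --> derive1 f p.
  exact: cvg_dnbhs_at_right hl.
have B : \forall h \near (0:R)^'+, - (f p / p) <= h^-1 *: ((f \o shift p) (h *: 1) - f p) <= 0.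
  near=> h.
  have h0 : 0 < h by [].
  have hp : h + p <= 2.
    by rewrite -lerBrDr; near: h; apply: nbhs_right_le; rewrite subr_gt0.
  rewrite /= /GRing.scale/= mulr1.
  have pq : p <= h + p by lra.
  have d := f_dec (ltW p1) pq hp; have i := pf_inc (ltW p1) pq hp.
  apply/andP; split; last by rewrite ler_pdivrMl// mulr0 subr_le0.
  rewrite ler_pdivlMl//.
  have -> : h * - (f p / p) = - (h * f p) / p by field; rewrite gt_eqF.
  rewrite ler_pdivrMr//.
  have : h * f (h + p) <= h * f p by apply: ler_wpM2l => //; exact: ltW.
  lra.
split.
  apply: (ler_cvg_to (@cvg_cst _ (- (f p / p)) _ _ _) hr).
  by apply: filterS B => h /andP[].
apply: (ler_cvg_to hr (@cvg_cst _ 0 _ _ _)).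
by apply: filterS B => h /andP[].
Unshelve. all: by end_near. Qed.

Lemma profile_ae_derive : {ae mu, forall p : R, 1 <= p <= 2 ->
  [/\ derivable f p 1, - (f p / p) <= derive1 f p & derive1 f p <= 0]}.
Proof.
(* The endpoints are discarded as null sets, since nothing is known about [f] beyond them. *)
have ne (x : R) : {ae mu, forall p, p != x}.
  exists [set x]; split; [exact: measurable_set1|exact: lebesgue_measure_set1|].
  by move=> p /= /negP; rewrite negbK => /eqP.
move: (ne 1) (ne 2) profile_ae_derivable; apply: filterS3.
  exact: (ae_filter_ringOfSetsType mu).
move=> p /= p1 p2 dp /andP[h1 h2].
have p12 : 1 < p < 2 by rewrite !lt_neqAle h1 h2 p2 eq_sym p1.
have d := dp p12.
by have [] := profile_derive_bounds p12 d.
Qed.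

End MonotoneProfile.

(** * The estimates for [S_p] and its real-valued version *)

Section Exponents.
Context {R : realType} (lam : nat -> R).
Implicit Types p q : R.
Hypothesis hlam : frequency lam.
Local Open Scope ereal_scope.

Lemma freqL_half_le_S_p p : (1 <= p)%R -> freqL lam * 2^-1%:E <= S_p lam p.
Proof.
move=> p1; have := S_p_ge0 hlam p1; case E : (S_p lam p) => [v| |]//; last first.
  by move=> _; rewrite leey.
rewrite lee_fin => v0.
have := @freqL_le_S_p _ _ hlam p v p1 v0; rewrite E lexx => /(_ isT).
have := freqL_ge0 hlam; case: (freqL lam) => [L| |]//.
by rewrite -EFinM !lee_fin; lra.
Qed.

Lemma mul_S_p_le p q : (1 <= p)%R -> (p <= q)%R ->
  p%:E * S_p lam p <= q%:E * S_p lam q.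
Proof.
move=> p1 pq; have q1 : (1 <= q)%R by lra.
have p0 : (0 < p)%R by lra.
have q0 : (0 < q)%R by lra.
have := S_p_ge0 hlam q1; case E : (S_p lam q) => [s| |]// s0; last first.
  by rewrite gt0_muley ?lte_fin// leey.
have h : S_p lam p <= (q / p * s)%:E.
  apply: (S_p_le hlam p1); first by apply: mulr_ge0 => //; apply: divr_ge0; exact: ltW.
  by move=> a ha; apply: (sigma_a_interpolation hlam p1 pq) => //; rewrite E.
apply: (@le_trans _ _ (p%:E * (q / p * s)%:E)).
  by apply: lee_wpmul2l => //; rewrite lee_fin ltW.
rewrite -!EFinM lee_fin.
have -> : (p * (q / p * s) = q * s)%R by field; rewrite gt_eqF.
by [].
Qed.

Lemma S_p_le_freqL p : (1 <= p <= 2)%R -> S_p lam p <= freqL lam * p^-1%:E.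
Proof.
move=> /andP[p1 p2]; have p0 : (0 < p)%R by lra.
have := freqL_ge0 hlam; case E : (freqL lam) => [L| |]// L0; last first.
  by rewrite gt0_mulye ?lte_fin ?invr_gt0// leey.
rewrite lee_fin in L0.
have h2 := S_2_le hlam E.
rewrite -EFinM; apply: (S_p_le hlam p1); first by rewrite mulr_ge0// invr_ge0 ltW.
move=> a ha.
have := sigma_a_interpolation hlam p1 p2 (divr_ge0 L0 (ltac:(lra) : 0 <= 2 :> R)%R) h2 ha.
suff -> : (2 / p * (L / 2) = L * p^-1)%R by [].
by field; rewrite gt_eqF.
Qed.

Lemma S_pE p : (2 <= p)%R -> S_p lam p = freqL lam * 2^-1%:E.
Proof.
move=> p2; have p1 : (1 <= p)%R by lra.
apply/eqP; rewrite eq_le freqL_half_le_S_p// andbT.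
apply: (@le_trans _ _ (S_p lam 2)); first by apply: (le_S_p hlam) => //; lra.
by apply: S_p_le_freqL; lra.
Qed.

Lemma S_pR_ge0 p : (1 <= p)%R -> (0 <= S_pR lam p)%R.
Proof. by move=> p1; apply/fine_ge0/(S_p_ge0 hlam). Qed.

(** Here the lower bound forces [S_p] to be infinite for every [p >= 1], and [fine] sends it to 0;
    the claims on regularity then concern the zero function. *)
Lemma S_pR_infinite p : freqL lam = +oo -> (1 <= p)%R -> S_pR lam p = 0%R.
Proof.
move=> Ly p1; have := freqL_half_le_S_p p1.
by rewrite Ly gt0_mulye ?lte_fin ?invr_gt0// leye_eq /S_pR => /eqP ->.
Qed.

Lemma S_pR_finite p : freqL lam != +oo -> (1 <= p <= 2)%R -> (S_pR lam p)%:E = S_p lam p.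
Proof.
move=> Lfin p12; apply: fineK; rewrite ge0_fin_numE; last first.
  by apply: (S_p_ge0 hlam); case/andP: p12.
apply: (le_lt_trans (S_p_le_freqL p12)).
have := freqL_ge0 hlam; case: (freqL lam) Lfin => [L| |]// _ _.
by rewrite -EFinM ltry.
Qed.

Lemma le_of_EFin (x y : R) (X Y : \bar R) : x%:E = X -> y%:E = Y ->
  X <= Y -> (x <= y)%R.
Proof. by move=> <- <-; rewrite lee_fin. Qed.

Lemma mul_le_of_EFin (p q x y : R) (X Y : \bar R) : x%:E = X -> y%:E = Y ->
  p%:E * X <= q%:E * Y -> (p * x <= q * y)%R.
Proof. by move=> <- <-; rewrite -!EFinM lee_fin. Qed.

Lemma S_pR_profile :
  [/\ forall p, (1 <= p <= 2)%R -> (0 <= S_pR lam p)%R,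
   forall p q, (1 <= p -> p <= q -> q <= 2 -> S_pR lam q <= S_pR lam p)%R &
   forall p q, (1 <= p -> p <= q -> q <= 2 -> p * S_pR lam p <= q * S_pR lam q)%R].
Proof.
have [Ly|Lfin] := eqVneq (freqL lam) +oo.
  split; [by move=> p /andP[p1 _]; exact: S_pR_ge0| |] => p q p1 pq _;
    have q1 : (1 <= q)%R by lra.
    by rewrite (S_pR_infinite Ly p1) (S_pR_infinite Ly q1).
  by rewrite (S_pR_infinite Ly p1) (S_pR_infinite Ly q1) !mulr0.
split; [by move=> p /andP[p1 _]; exact: S_pR_ge0| |] => p q p1 pq q2;
  have p12 : (1 <= p <= 2)%R by lra.
  have q12 : (1 <= q <= 2)%R by lra.
  exact: (le_of_EFin (S_pR_finite Lfin q12) (S_pR_finite Lfin p12) (le_S_p hlam p1 pq)).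
have q12 : (1 <= q <= 2)%R by lra.
exact: (mul_le_of_EFin (S_pR_finite Lfin p12) (S_pR_finite Lfin q12) (mul_S_p_le p1 pq)).
Qed.

End Exponents.

Unset Implicit Arguments.

Theorem theorem1p7 (R : realType) (lam : nat -> R) (hlam : frequency lam) :
  [/\ (forall p : R, 1 <= p <= 2 ->
         (freqL lam * 2^-1%:E <= S_p lam p <= freqL lam * p^-1%:E)%E),
      (forall p : R, 2 <= p -> S_p lam p = (freqL lam * 2^-1%:E)%E),
      (forall p q : R, 1 <= p -> p <= q -> q <= 2 ->
         (p%:E * S_p lam p <= q%:E * S_p lam q)%E),
      [lipschitz S_pR lam p | p in `[1, 2] ] &
      {ae lebesgue_measure, forall p : R, 1 <= p <= 2 ->
         [/\ derivable (S_pR lam) p 1,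
             - (S_pR lam p / p) <= derive1 (S_pR lam) p &
             derive1 (S_pR lam) p <= 0]}].
Proof.
have [f0 fd fi] := S_pR_profile hlam.
split.
- move=> p p12; apply/andP; split; last exact: S_p_le_freqL.
  by apply: freqL_half_le_S_p => //; case/andP: p12.
- by move=> p; exact: S_pE.
- by move=> p q p1 pq _; exact: mul_S_p_le.
- exact: profile_lipschitz.
- exact: profile_ae_derive.
Qed.
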